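(* Let $(M,\varphi,\xi,\eta,g)$ be a Sasakian manifold, and suppose that $(M,g)$ satisfies the generalised Ricci soliton equation $$\operatorname{Hess} f_1=-c_1\,df_2\odot df_2+c_2\operatorname{Ric}+\lambda g,$$ where $f_1,f_2\in C^\infty(M)$ and $c_1,c_2,\lambda\in\mathbb{R}$ are constants. Then $$\operatorname{grad} f_1+c_1\,\xi(\xi(f_2))\operatorname{grad} f_2-c_1\,\xi(f_2)\,\nabla_\xi\operatorname{grad} f_2=\xi(f_1)\,\xi .$$
   Context: Conventions for a smooth Riemannian manifold $(M,g)$: $\nabla$ is the Levi-Civita connection; $R(X,Y)Z=\nabla_X\nabla_YZ-\nabla_Y\nabla_XZ-\nabla_{[X,Y]}Z$; $\operatorname{Ric}(X,Y)=\sum_i g(R(X,e_i)e_i,Y)$ for a local orthonormal frame $\{e_i\}$; $\operatorname{grad} f$ is defined by $g(\operatorname{grad} f,X)=X(f)$; $(\operatorname{Hess} f)(X,Y)=g(\nabla_X\operatorname{grad} f,Y)$; and $(df\odot df)(X,Y)=X(f)Y(f)$. Almost contact metric manifold: a Riemannian manifold $(M,g)$ of dimension $2n+1$ with a $(1,1)$-tensor field $\varphi$, a vector field $\xi$ and a $1$-form $\eta$ such that $\eta(\xi)=1$, $\varphi^2X=-X+\eta(X)\xi$ and $g(\varphi X,\varphi Y)=g(X,Y)-\eta(X)\eta(Y)$ for all vector fields $X,Y$ (in particular $\varphi\xi=0$ and $\eta\circ\varphi=0$). It is a contact metric manifold if $d\eta(X,Y)=g(X,\varphi Y)$ for all $X,Y$,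 with the convention $d\eta(X,Y)=\tfrac12\big(X\eta(Y)-Y\eta(X)-\eta([X,Y])\big)$. It is normal if $[\varphi,\varphi](X,Y)=-2\,d\eta(X,Y)\,\xi$, where $[\varphi,\varphi](X,Y)=\varphi^2[X,Y]+[\varphi X,\varphi Y]-\varphi[\varphi X,Y]-\varphi[X,\varphi Y]$. A Sasakian manifold is a normal contact metric manifold; equivalently, an almost contact metric manifold satisfying $(\nabla_X\varphi)Y=g(X,Y)\xi-\eta(Y)X$ for all vector fields $X,Y$. On a Sasakian manifold one has $\nabla_X\xi=-\varphi X$, $\xi$ is a Killing vector field, and $R(X,Y)\xi=\eta(Y)X-\eta(X)Y$. *)

(* Defs.v *)
(* The tangent space of an m-dimensional manifold at a point p is 'rV[R]_m,   *)
(* the components of a vector being taken in a preferred chart chart_at p     *)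
(* around p; a change of preferred chart acts on the components through the   *)
(* Jacobian of the transition map. Tensor fields and vector fields are total  *)
(* functions, whose smoothness is a predicate relative to an open set U.      *)
(* Identities between vector fields are quantified over the fields X, Y, ...  *)
(* that are smooth on an arbitrary open set U (U := setT gives global         *)
(* fields), and they are asserted on U.                                       *)
From HB Require Import structures.
From mathcomp Require Import all_boot all_order all_algebra.
From mathcomp Require Import all_classical all_reals all_analysis.
Set Implicit Arguments.
Unset Strict Implicit.
Unset Printing Implicit Defensive.
Import Order.TTheory GRing.Theory Num.Theory.
Import numFieldNormedType.Exports.
Local Open Scope classical_set_scope.
Local Open Scope ring_scope.

(* Smooth functions on an open subset U of R^m: the partial derivatives of    *)
(* all orders exist and are continuous on U.                                  *)
Fixpoint is_Ck {R : realType} {m : nat} (k : nat) (U : set 'rV[R]_m)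
    (f : 'rV[R]_m -> R) : Prop :=
  (forall x, U x -> {for x, continuous f}) /\
  match k with
  | 0%N => True
  | k'.+1 => forall i : 'I_m,
      (forall x, U x -> derivable f x (delta_mx 0 i)) /\
      is_Ck k' U ('D_(delta_mx 0 i) f)
  end.

Definition is_Coo {R : realType} {m : nat} (U : set 'rV[R]_m)
    (f : 'rV[R]_m -> R) : Prop := forall k, is_Ck k U f.

(* [cinv] is relevant only on the image of [cdom].                            *)
Record chart (R : realType) (m : nat) (M : topologicalType) := Chart {
  cdom : set M;
  cmap : M -> 'rV[R]_m;
  cinv : 'rV[R]_m -> M;
  cdom_open : open cdom;
  cimg_open : open (cmap @` cdom);
  cmapK : forall p, cdom p -> cinv (cmap p) = p;
  cmap_continuous : forall p, cdom p -> {for p, continuous cmap};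
  cinv_continuous : forall x, (cmap @` cdom) x -> {for x, continuous cinv} }.

Record manifold (R : realType) (m : nat) := Manifold {
  carrier :> topologicalType;
  manifold_hausdorff : hausdorff_space carrier;
  manifold_second_countable : @second_countable carrier;
  atlas : set (chart R m carrier);
  atlas_cover : forall p, exists c, atlas c /\ cdom c p;
  atlas_compatible : forall c d, atlas c -> atlas d -> forall i : 'I_m,
    is_Coo (cmap c @` (cdom c `&` cdom d)) (fun x => cmap d (cinv c x) 0 i) }.

Definition chart_at {R : realType} {m : nat} (M : manifold R m) (p : M) :
  chart R m M := projT1 (cid (atlas_cover p)).

Definition smooth_on {R : realType} {m : nat} (M : manifold R m) (U : set M)
    (f : M -> R) : Prop :=
  forall c, @atlas R m M c ->
    is_Coo (cmap c @` (U `&` cdom c)) (fun x => f (cinv c x)).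

Definition vfield {R : realType} {m : nat} (M : manifold R m) : Type :=
  M -> 'rV[R]_m.

(* The function X(f). *)
Definition dirder {R : realType} {m : nat} (M : manifold R m) (X : vfield M)
    (f : M -> R) (p : M) : R :=
  let c := chart_at p in
  'D_(X p) (fun x => f (cinv c x)) (cmap c p).

(* The components X(x^i) of X in every chart are smooth.                      *)
Definition smooth_field {R : realType} {m : nat} (M : manifold R m)
    (U : set M) (X : vfield M) : Prop :=
  forall c, @atlas R m M c -> forall i : 'I_m,
    smooth_on (U `&` cdom c) (dirder X (fun q => cmap c q 0 i)).

(* [X,Y]^i = X(Y(x^i)) - Y(X(x^i)) for the coordinates x^i of chart_at p.     *)
Definition bracket {R : realType} {m : nat} (M : manifold R m)
    (X Y : vfield M) : vfield M :=
  fun p => \row_(i < m)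
    let xi := fun q => cmap (chart_at p) q 0 i in
    (dirder X (dirder Y xi) p - dirder Y (dirder X xi) p).

Record riemannian_metric {R : realType} {m : nat} (M : manifold R m) :=
  RiemannianMetric {
  metric :> M -> 'rV[R]_m -> 'rV[R]_m -> R;
  metric_linear : forall p u, scalar (metric p u);
  metric_sym : forall p u v, metric p u v = metric p v u;
  metric_pos : forall p u, u != 0 -> 0 < metric p u u;
  metric_smooth : forall (U : set M) X Y, open U ->
    smooth_field U X -> smooth_field U Y ->
    smooth_on U (fun p => metric p (X p) (Y p)) }.

(* [nabla X Y] is constrained only where X and Y are smooth.                  *)
Record levi_civita {R : realType} {m : nat} (M : manifold R m)
    (g : riemannian_metric M) (nabla : vfield M -> vfield M -> vfield M) :
    Prop := LeviCivita {
  lc_smooth : forall (U : set M) X Y, open U ->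
    smooth_field U X -> smooth_field U Y -> smooth_field U (nabla X Y);
  lc_linear : forall (U : set M) f X X' Y, open U -> smooth_on U f ->
    smooth_field U X -> smooth_field U X' -> smooth_field U Y ->
    forall p, U p ->
    nabla (fun q => f q *: X q + X' q) Y p = f p *: nabla X Y p + nabla X' Y p;
  lc_additive : forall (U : set M) X Y Y', open U ->
    smooth_field U X -> smooth_field U Y -> smooth_field U Y' ->
    forall p, U p ->
    nabla X (fun q => Y q + Y' q) p = nabla X Y p + nabla X Y' p;
  lc_leibniz : forall (U : set M) f X Y, open U -> smooth_on U f ->
    smooth_field U X -> smooth_field U Y ->
    forall p, U p ->
    nabla X (fun q => f q *: Y q) p
      = dirder X f p *: Y p + f p *: nabla X Y p;
  lc_torsion_free : forall (U : set M) X Y, open U ->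
    smooth_field U X -> smooth_field U Y ->
    forall p, U p -> nabla X Y p - nabla Y X p = bracket X Y p;
  lc_metric : forall (U : set M) X Y Z, open U ->
    smooth_field U X -> smooth_field U Y -> smooth_field U Z ->
    forall p, U p ->
    dirder X (fun q => g q (Y q) (Z q)) p
      = g p (nabla X Y p) (Z p) + g p (Y p) (nabla X Z p) }.

Definition curvature {R : realType} {m : nat} (M : manifold R m)
    (nabla : vfield M -> vfield M -> vfield M) (X Y Z : vfield M) : vfield M :=
  fun p => nabla X (nabla Y Z) p - nabla Y (nabla X Z) p
           - nabla (bracket X Y) Z p.

Definition orthonormal_frame {R : realType} {m : nat} (M : manifold R m)
    (g : riemannian_metric M) (U : set M) (e : 'I_m -> vfield M) : Prop :=
  (forall i, smooth_field U (e i)) /\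
  (forall p, U p -> forall i j, g p (e i p) (e j p) = (i == j)%:R).

Definition frame_at {R : realType} {m : nat} (M : manifold R m)
    (g : riemannian_metric M) (p : M) : 'I_m -> vfield M :=
  xget (fun _ _ => 0)
    [set e : 'I_m -> M -> 'rV[R]_m |
      exists U : set M, [/\ open U, U p & orthonormal_frame g U e]].

Definition ricci {R : realType} {m : nat} (M : manifold R m)
    (g : riemannian_metric M) (nabla : vfield M -> vfield M -> vfield M)
    (X Y : vfield M) (p : M) : R :=
  let e := frame_at g p in
  \sum_(i < m) g p (curvature nabla X (e i) (e i) p) (Y p).

(* The vector grad f at p is determined by g(grad f, v) = v(f).               *)
Definition grad {R : realType} {m : nat} (M : manifold R m)
    (g : riemannian_metric M) (f : M -> R) : vfield M :=
  fun p => xget 0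
    [set u : 'rV[R]_m |
      forall v, g p u v = dirder (fun _ => v) f p].

Definition hessian {R : realType} {m : nat} (M : manifold R m)
    (g : riemannian_metric M) (nabla : vfield M -> vfield M -> vfield M)
    (f : M -> R) (X Y : vfield M) (p : M) : R :=
  g p (nabla X (grad g f) p) (Y p).

Definition dfdf {R : realType} {m : nat} (M : manifold R m)
    (f : M -> R) (X Y : vfield M) (p : M) : R :=
  dirder X f p * dirder Y f p.

Record almost_contact_metric {R : realType} {m : nat} (M : manifold R m)
    (g : riemannian_metric M) (phi : M -> 'rV[R]_m -> 'rV[R]_m)
    (xi : vfield M) (eta : M -> 'rV[R]_m -> R) : Prop := AlmostContactMetric {
  acm_phi_linear : forall p, linear (phi p);
  acm_phi_smooth : forall (U : set M) X, open U -> smooth_field U X ->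
    smooth_field U (fun p => phi p (X p));
  acm_xi_smooth : smooth_field setT xi;
  acm_eta_linear : forall p, scalar (eta p);
  acm_eta_smooth : forall (U : set M) X, open U -> smooth_field U X ->
    smooth_on U (fun p => eta p (X p));
  acm_eta_xi : forall p, eta p (xi p) = 1;
  acm_phi2 : forall p u, phi p (phi p u) = - u + eta p u *: xi p;
  acm_compatible : forall p u v,
    g p (phi p u) (phi p v) = g p u v - eta p u * eta p v }.

(* Exterior derivative of a 1-form, with the factor 1/2.                      *)
Definition dform {R : realType} {m : nat} (M : manifold R m)
    (eta : M -> 'rV[R]_m -> R) (X Y : vfield M) (p : M) : R :=
  2^-1 * (dirder X (fun q => eta q (Y q)) p
          - dirder Y (fun q => eta q (X q)) p
          - eta p (bracket X Y p)).

Definition contact_metric {R : realType} {m : nat} (M : manifold R m)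
    (g : riemannian_metric M) (phi : M -> 'rV[R]_m -> 'rV[R]_m)
    (xi : vfield M) (eta : M -> 'rV[R]_m -> R) : Prop :=
  almost_contact_metric g phi xi eta /\
  forall (U : set M) X Y, open U -> smooth_field U X -> smooth_field U Y ->
    forall p, U p -> dform eta X Y p = g p (X p) (phi p (Y p)).

(* [phi,phi](X,Y) *)
Definition nijenhuis {R : realType} {m : nat} (M : manifold R m)
    (phi : M -> 'rV[R]_m -> 'rV[R]_m) (X Y : vfield M) : vfield M :=
  let phiX := fun p => phi p (X p) in
  let phiY := fun p => phi p (Y p) in
  fun p => phi p (phi p (bracket X Y p)) + bracket phiX phiY p
           - phi p (bracket phiX Y p) - phi p (bracket X phiY p).

Definition normal {R : realType} {m : nat} (M : manifold R m)
    (phi : M -> 'rV[R]_m -> 'rV[R]_m) (xi : vfield M)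
    (eta : M -> 'rV[R]_m -> R) : Prop :=
  forall (U : set M) X Y, open U -> smooth_field U X -> smooth_field U Y ->
    forall p, U p -> nijenhuis phi X Y p = - (2 * dform eta X Y p) *: xi p.

Definition sasakian {R : realType} {m : nat} (M : manifold R m)
    (g : riemannian_metric M) (phi : M -> 'rV[R]_m -> 'rV[R]_m)
    (xi : vfield M) (eta : M -> 'rV[R]_m -> R) : Prop :=
  contact_metric g phi xi eta /\ normal phi xi eta.

Definition generalised_ricci_soliton {R : realType} {m : nat}
    (M : manifold R m) (g : riemannian_metric M)
    (nabla : vfield M -> vfield M -> vfield M)
    (f1 f2 : M -> R) (c1 c2 lambda : R) : Prop :=
  forall (U : set M) X Y, open U -> smooth_field U X -> smooth_field U Y ->
    forall p, U p ->
    hessian g nabla f1 X Y p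
      = - c1 * dfdf f2 X Y p + c2 * ricci g nabla X Y p
        + lambda * g p (X p) (Y p).

(* Main.v *)
Require Import Defs.
From HB Require Import structures.
From mathcomp Require Import all_boot all_order all_algebra.
From mathcomp Require Import all_classical all_reals all_analysis.
From mathcomp Require Import ring lra.
Set Implicit Arguments.
Unset Strict Implicit.
Unset Printing Implicit Defensive.
Import Order.TTheory GRing.Theory Num.Theory.
Import numFieldNormedType.Exports.
Local Open Scope classical_set_scope.
Local Open Scope ring_scope.

(** The soliton equation is used only with one argument equal to the Reeb
    field xi.  Write a = xi(f1) and b = xi(f2).  On a Sasakian manifold
    Ric(xi, Y) = (m - 1) eta(Y), where m is the dimension, and
    nabla_Y xi = - phi Y, so that Hess f (xi, Y) = Y(xi f) + (phi Y) f for every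
    function f.  Hence, with the constant mu = c2 (m - 1) + lambda,
    [Y(a) + (phi Y)(f1) = - c1 b Y(f2) + mu eta(Y)]
    for every field Y.  This is an equality between 1-forms, from which the
    theorem follows in two steps.  First, it is differentiated along xi: the Lie
    derivative along xi annihilates eta and phi, and it maps dh to d(xi h).
    Since xi(a) = mu - c1 b^2 (take Y = xi), this gives
    [(phi Y)(a) = c1 b Y(b) - c1 xi(b) Y(f2)].
    Secondly, the equation at phi Y expresses (phi Y)(a) through
    Y(f1) - eta(Y) a and (phi Y)(f2).  Comparing the two, and recognising
    Y(b) + (phi Y)(f2) = g(nabla_xi grad f2, Y) as a Hessian, one finds the scalar
    product with Y of the required identity (soliton_field).

    The facts on Sasakian manifolds come from the definition (a normal contact
    metric structure).  Normality and the contact condition give L_xi eta = 0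
    and L_xi phi = 0 (lie_eta, lie_phi); the contact condition then gives
    L_xi g = 0 (lie_metric), hence nabla_X xi = - phi X (nabla_xi).
    The exterior derivative of d eta and the Nijenhuis tensor determine the
    covariant derivative of phi (nabla_phiE).  As the flow of xi consists of
    isometries it preserves nabla (lie_nabla_eq0), and this turns R(xi, X) Y into
    (nabla_X phi) Y (curvature_xi), whose trace is the Ricci curvature (ricci_xi).

    All these computations take place on vector fields that are smooth on an
    open set.  They rest on three foundations: a calculus of smooth functions
    of several variables (differentiability from continuous partial
    derivatives, chain rule, symmetry of second derivatives); the fact that
    the bracket, defined in coordinates, is the commutator of derivations
    (bracketE), from which the Jacobi identity follows; and the existence of
    local orthonormal frames (frame_atP), which shows that gradients exist
    and are smooth and which computes the Ricci trace. *)

(** * Differentiability from continuous partial derivatives *)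

(** The value of ['d f x] is chosen among the linear approximations of f at x,
    and it is unique; so any explicit approximation is the differential. *)
Lemma differentiable_linear_approx (R : realType) (V W : normedModType R) (f : V -> W)
    (df : {linear V -> W}) x : continuous df ->
  (forall e : R, 0 < e -> \forall h \near (0 : V),
    `|f (h + x) - f x - df h| <= e * `|h|) -> differentiable f x.
Proof.
move=> dfc H; have Ld : f \o shift x = cst (f x) + df +o_ 0 id.
  apply/eqaddoP => _/posnumP[eps]; apply: filterS (H _ [gt0 of eps%:num]) => h /=.
  by rewrite !fctE /cst/= opprD addrA.
have dE := diff_unique dfc Ld.
by apply/diff_locallyP; rewrite dE.
Qed.

(** A derivative depends only on the function on a line through the point.
    This identifies a directional derivative with the derivative of a function
    of one variable, for which the chain rule is available. *)
Lemma eq_is_derive_growth (R : numFieldType) (V V' W : normedModType R)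
    (f : V -> W) (g : V' -> W) x v y w d :
  (forall h : R, f (h *: v + x) = g (h *: w + y)) ->
  is_derive x v f d -> is_derive y w g d.
Proof.
move=> fg; have fg0 : f x = g y by have := fg 0; rewrite !scale0r !add0r.
have eqg : (fun h : R => h^-1 *: ((f \o shift x) (h *: v) - f x))
         = (fun h => h^-1 *: ((g \o shift y) (h *: w) - g y)).
  by apply/funext => h /=; rewrite fg fg0.
by case=> df <-; apply: DeriveDef; [move: df|]; rewrite /derivable /derive eqg.
Qed.

Section Euclidean.
Context {R : realType} {m : nat}.
Notation E := 'rV[R]_m.
Notation e_ i := (delta_mx (0 : 'I_1) i : E).
Implicit Types (f g : E -> R) (U V : set E).

Lemma is_derive_line f (y v : E) (s d : R) :
  is_derive (y + s *: v) v f d -> is_derive s 1 (fun t => f (y + t *: v)) d.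
Proof.
apply: eq_is_derive_growth => h /=; congr f.
by rewrite scalerDl addrCA [h *: 1]mulr1.
Qed.

(** The sign of t is arbitrary, because the coordinates of an increment have
    arbitrary signs. *)
Lemma mvt_line f (y v : E) (t : R) :
  (forall s : R, `|s| <= `|t| -> derivable f (y + s *: v) v) ->
  exists2 s : R, `|s| <= `|t| & f (y + t *: v) - f y = 'D_v f (y + s *: v) * t.
Proof.
move=> df; pose p (s : R) := f (y + s *: v).
have dp (s : R) : `|s| <= `|t| -> is_derive s 1 p ('D_v f (y + s *: v)).
  by move=> st; apply/is_derive_line/derivableP/df.
have cp (a b : R) : (forall s : R, s \in `[a, b]%R -> `|s| <= `|t|) ->
    {within `[a, b], continuous p}.
  move=> ab; apply: derivable_within_continuous => s sab.
  by have [] := dp s (ab s sab).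
have [t0|t0] := leP 0 t.
  have H (s : R) : s \in `[0, t]%R -> `|s| <= `|t|.
    by rewrite in_itv/= => /andP[s0 st]; rewrite !ger0_norm.
  have [|||s sI] := @MVT_segment R p (fun s => 'D_v f (y + s *: v)) 0 t.
  - exact: t0.
  - by move=> s sI; apply/dp/H/subset_itv_oo_cc.
  - exact: cp.
  rewrite /p scale0r addr0 subr0 => ps; exists s => //; exact: H.
have H (s : R) : s \in `[t, 0]%R -> `|s| <= `|t|.
  by rewrite in_itv/= => /andP[s0 st]; rewrite !ler0_norm ?lerN2// ltW.
have [|||s sI] := @MVT_segment R p (fun s => 'D_v f (y + s *: v)) t 0.
- exact: ltW.
- by move=> s sI; apply/dp/H/subset_itv_oo_cc.
- exact: cp.
rewrite /p scale0r addr0 sub0r => ps; exists s; first exact: H.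
by rewrite -opprB ps mulrN opprK.
Qed.

Lemma rV_norm_le (x : E) (c : R) : 0 <= c -> (forall i, `|x 0 i| <= c) -> `|x| <= c.
Proof.
move=> c0 xc; rewrite /Num.Def.normr/= mx_normrE; apply: bigmax_le => // -[i j] _ /=.
by rewrite (ord1 i).
Qed.

Lemma rV_coord_le (x : E) i : `|x 0 i| <= `|x|.
Proof.
rewrite [leRHS]/Num.Def.normr/= mx_normrE.
exact: (le_bigmax _ (fun ij : 'I_1 * 'I_m => `|x ij.1 ij.2|) (0, i)).
Qed.

Lemma open_ball_in U x : open U -> U x ->
  exists2 d : R, 0 < d & forall y, `|y - x| < d -> U y.
Proof.
rewrite openE => oU Ux; have /nbhs_ballP[d d0 dU] := oU x Ux.
exists d => // y yx; apply: dU; rewrite -ball_normE /ball_/=.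
by rewrite distrC.
Qed.

Lemma continuous_ball f x e : {for x, continuous f} -> 0 < e ->
  exists2 d : R, 0 < d & forall y, `|y - x| < d -> `|f y - f x| < e.
Proof.
move=> fx e0; have /cvgrPdist_lt/(_ _ e0)/nbhs_ballP[d d0 H] := fx.
exists d => // y yx; rewrite distrC; apply: H; rewrite -ball_normE /ball_/=.
by rewrite distrC.
Qed.

(** The points x + cut h k, for k from 0 to m, are the vertices of a path from
    x to x + h whose edges are parallel to the coordinate axes. *)
Definition cut (h : E) (k : nat) : E := \row_i (if (i < k)%N then h 0 i else 0).

Lemma cut0 h : cut h 0 = 0.
Proof. by apply/rowP => i; rewrite !mxE. Qed.

Lemma cut_full h : cut h m = h.
Proof. by apply/rowP => i; rewrite !mxE ltn_ord. Qed.

Lemma cutS h (i : 'I_m) : cut h i.+1 = cut h i + h 0 i *: e_ i.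
Proof.
apply/rowP => j; rewrite !mxE eqxx/= ltnS leq_eqVlt.
have [->|ji] := eqVneq j i; first by rewrite eqxx ltnn mulr1 add0r.
by rewrite (negbTE (ji : (j : nat) != i)) mulr0 addr0.
Qed.

(** The edges of the path stay in the ball of radius |h|, because the norm is
    the maximum of the coordinates. *)
Lemma norm_cut_add (h : E) (i : 'I_m) (s : R) : `|s| <= `|h 0 i| ->
  `|cut h i + s *: e_ i| <= `|h|.
Proof.
move=> sh; apply: rV_norm_le => // j; rewrite !mxE eqxx/=.
have [->|ji] := eqVneq j i.
  by rewrite ltnn mulr1 add0r (le_trans sh)// rV_coord_le.
rewrite mulr0 addr0; case: ifP => _; first exact: rV_coord_le.
by rewrite normr0.
Qed.

(** Along each edge of the path from x to x + h the mean value theorem turns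
    the increment of f into a coordinate of h times a partial derivative at a
    point close to x; by continuity this derivative is close to its value at x. *)
Lemma differentiable_partials f U x : open U -> U x ->
  (forall i y, U y -> derivable f y (e_ i)) ->
  (forall i, {for x, continuous ('D_(e_ i) f)}) -> differentiable f x.
Proof.
move=> oU Ux df cf.
pose L (h : E) : R := \sum_i h 0 i * 'D_(e_ i) f x.
have Llin : linear L.
  move=> a u v; rewrite /L scaler_sumr -big_split/=; apply: eq_bigr => i _.
  by rewrite !mxE mulrDl scalerAl.
pose Ll : {linear E -> R} := HB.pack L (GRing.isLinear.Build _ _ _ _ L Llin).
have Lc : continuous Ll.
  have -> : Ll = (fun h : E => \sum_i h 0 i * 'D_(e_ i) f x) :> (E -> R) by [].
  apply: (continuous_big (op := +%R) (x0 := 0 : R)) => [|i _]; first exact: add_continuous.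
  move=> h; apply: (@cvgM _ _ (nbhs h)); last exact: cvg_cst.
  exact: coord_continuous.
apply: (differentiable_linear_approx Lc) => _/posnumP[eps].
  (* each of the m edges contributes an error of at most eta |h| *)
  pose eta := eps%:num / m.+1%:R; have eta0 : 0 < eta by rewrite divr_gt0.
  have [d0 d0p Hd0] := open_ball_in oU Ux.
  have [d dp Hd] : exists2 d, 0 < d & forall i y, `|y - x| < d ->
      `|'D_(e_ i) f y - 'D_(e_ i) f x| < eta.
    pose dd i := projT1 (cid2 (continuous_ball (cf i) eta0)).
    have ddp i : 0 < dd i by rewrite /dd; case: cid2.
    exists (\big[Num.min/1]_i dd i).
      by apply: lt_bigmin => // i _; exact: ddp.
    move=> i y yx; have : `|y - x| < dd i.
      by apply: (lt_le_trans yx); exact: bigmin_le_cond.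
    by rewrite /dd; case: cid2 => /= r _; apply.
  apply/nbhs_normP; exists (Num.min d d0) => /=; first by rewrite lt_min dp d0p.
  move=> h; rewrite /= sub0r normrN lt_min => /andP[hd hd0].
  rewrite [h + x]addrC; change (`|f (x + h) - f x - L h| <= eps%:num * `|h|).
  have -> : f (x + h) - f x = \sum_(i < m) (f (x + cut h i.+1) - f (x + cut h i)).
    rewrite -(big_mkord xpredT (fun i => f (x + cut h i.+1) - f (x + cut h i))).
    by rewrite telescope_sumr// cut0 cut_full addr0.
  rewrite -sumrB (le_trans (ler_norm_sum _ _ _))//.
  apply: (@le_trans _ _ (\sum_(i < m) eta * `|h|)); last first.
    rewrite sumr_const card_ord -[leLHS]mulr_natr mulrAC ler_wpM2r//.
    rewrite /eta -mulrA ler_piMr// mulrC ler_pdivrMr ?mul1r ?ler_nat//.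
  apply: ler_sum => i _.
  have near_x (s : R) : `|s| <= `|h 0 i| ->
      `|(x + cut h i + s *: e_ i) - x| <= `|h|.
    by move=> sh; rewrite -(addrA x) addrAC subrr add0r norm_cut_add.
  rewrite cutS addrA.
  have [s sh|s sh ->] := @mvt_line f (x + cut h i) (e_ i) (h 0 i).
    by apply/df/Hd0; apply: le_lt_trans hd0; exact: near_x.
  rewrite mulrC -mulrBr normrM mulrC ler_pM//; last exact: rV_coord_le.
  by apply/ltW/Hd; apply: le_lt_trans hd; exact: near_x.
Qed.

End Euclidean.

(** * Smooth functions of several variables *)

Section Chain.
Context {R : realType} {m m' : nat}.
Notation E := 'rV[R]_m.
Notation e_ i := (delta_mx (0 : 'I_1) i).

Lemma derive_partials (f : E -> R) x v : differentiable f x ->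
  'D_v f x = \sum_i v 0 i * 'D_(e_ i) f x.
Proof.
move=> df; rewrite deriveE// {1}[v]row_sum_delta linear_sum/=.
by apply: eq_bigr => i _; rewrite linearZ/= -deriveE.
Qed.

Lemma continuous_row (T : topologicalType) (F : T -> E) x :
  (forall i, {for x, continuous (fun y => F y 0 i : R)}) -> {for x, continuous F}.
Proof.
move=> Fc; apply/cvgrPdist_le => /= eps eps0; near=> y.
apply: rV_norm_le; first exact: ltW.
move=> i; rewrite !mxE; move: i; near: y; apply: filter_forall => i.
by have /cvgrPdist_le/(_ _ eps0) := Fc i.
Unshelve. all: by end_near. Qed.

(** The components of F need only be derivable in the direction v: the map
    [h |-> F (x + h v)] is then differentiable at 0, being a function of one real
    variable, and it can be composed with f. *)
Lemma derive_chain (f : E -> R) (F : 'rV[R]_m' -> E) x v :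
  differentiable f (F x) -> (forall j, derivable (fun y => F y 0 j) x v) ->
  is_derive x v (f \o F)
    (\sum_j 'D_v (fun y => F y 0 j) x * 'D_(e_ j) f (F x)).
Proof.
move=> df dF.
have dFx : derivable F x v by apply/derivable_mxP => i j; rewrite (ord1 i).
pose G (h : R) : E := F (h *: v + x).
have dG : is_derive (0 : R) 1 G ('D_v F x).
  apply: eq_is_derive_growth (derivableP dFx) => h.
  by rewrite /G addr0 [h *: 1]mulr1.
have G0 : G 0 = F x by rewrite /G scale0r add0r.
have GE h : G h = F (h *: v + x) by [].
move: G dG G0 GE => G dG G0 GE.
have difG : differentiable G 0 := (derivable1_diffP G 0).1 (@ex_derive _ _ _ _ _ _ _ dG).
have difFG : differentiable f (G 0) by rewrite G0.
have dfG : differentiable (f \o G) 0 by apply: differentiable_comp.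
have := derivableP (diff_derivable (v := 1 : R) dfG).
have dGE : 'd G 0 (1 : R) = 'D_v F x by rewrite -deriveE// derive_val.
rewrite deriveE// diff_comp//= dGE G0 -deriveE// derive_partials// derive_mx//.
rewrite (eq_bigr (fun j => 'D_v (fun y => F y 0 j) x * 'D_(e_ j) f (F x))); last first.
  by move=> j _; rewrite mxE.
apply: eq_is_derive_growth => h.
by rewrite /= GE addr0 [h *: 1]mulr1.
Qed.

Lemma derive_comp1 (f : E -> R) (r : R -> R) x v d :
  differentiable f x -> is_derive (f x) 1 r d ->
  is_derive x v (r \o f) (d * 'D_v f x).
Proof.
move=> df dr; have drf : differentiable r (f x) by apply/derivable1_diffP.
have dc : differentiable (r \o f) x by exact: differentiable_comp.
have -> : d * 'D_v f x = 'D_v (r \o f) x; last exact/derivableP/diff_derivable.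
have drE : 'd r (f x) (1 : R) = d by rewrite -deriveE// derive_val.
rewrite [RHS]deriveE// diff_comp//= -[X in 'd r _ X]mulr1.
by rewrite [RHS]linearZ/= drE -deriveE// mulrC.
Qed.

End Chain.

Section SmoothFunctions.
Context {R : realType} {m : nat}.
Notation E := 'rV[R]_m.
Notation e_ i := (delta_mx (0 : 'I_1) i).
Implicit Types (f g : E -> R) (U V : set E).

Lemma open_near U x (P : E -> Prop) : open U -> U x ->
  (forall y, U y -> P y) -> \forall y \near x, P y.
Proof.
by move=> oU Ux UP; apply: filterS UP _; apply: open_nbhs_nbhs.
Qed.

Lemma is_Ck_continuous k U f x : is_Ck k U f -> U x -> {for x, continuous f}.
Proof. by case: k => [|k] [] fc _; exact: fc. Qed.

Lemma is_CkS k U f : is_Ck k.+1 U f -> is_Ck k U f.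
Proof.
elim: k f => [|k IH] f [fc fD]; split=> // i.
by have [df Df] := fD i; split=> //; exact: IH.
Qed.

Lemma is_Ck_eq k U f g : open U -> (forall x, U x -> f x = g x) ->
  is_Ck k U f -> is_Ck k U g.
Proof.
move=> oU; have nfg f' g' x : (forall x, U x -> f' x = g' x) -> U x ->
    \forall y \near x, f' y = g' y :> R.
  by move=> fg Ux; exact: open_near oU Ux fg.
have gc f' g' : (forall x, U x -> f' x = g' x) ->
    (forall x, U x -> {for x, continuous f'}) ->
    forall x, U x -> {for x, continuous g'}.
  move=> fg fc x Ux; have := fc x Ux; rewrite /prop_for /continuous_at (fg x Ux).
  by apply: cvg_trans; apply: (@near_eq_cvg _ _ (nbhs x)); exact: nfg.
elim: k f g => [|k IH] f g fg [fc fD].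
  by split=> //; exact: gc fg fc.
split=> [|i]; first exact: gc fg fc.
have [df Df] := fD i; split=> [x Ux|].
  by apply: near_eq_derivable (df x Ux); exact: nfg.
by apply: IH Df => x Ux; apply: near_eq_derive; exact: nfg.
Qed.

Lemma is_Ck_sub k U V f : (forall x, V x -> U x) -> is_Ck k U f -> is_Ck k V f.
Proof.
move=> VU; elim: k f => [|k IH] f [fc fD].
  by split=> // x Vx; exact/fc/VU.
split=> [x Vx|i]; first exact/fc/VU.
by have [df Df] := fD i; split=> [x Vx|]; [exact/df/VU|exact: IH].
Qed.

Lemma is_Ck_local k U f : (forall x, U x -> exists V, V x /\ is_Ck k V f) ->
  is_Ck k U f.
Proof.
elim: k f => [|k IH] f H.
  by split=> // x Ux; have [V [Vx fV]] := H x Ux; exact: (is_Ck_continuous fV).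
split=> [x Ux|i].
  by have [V [Vx fV]] := H x Ux; exact: (is_Ck_continuous fV).
split=> [x Ux|].
  by have [V [Vx [_ /(_ i)[df _]]]] := H x Ux; exact: df.
apply: IH => x Ux; have [V [Vx [_ /(_ i)[_ fV]]]] := H x Ux.
by exists V.
Qed.

Lemma is_Ck_differentiable k U f x : open U -> is_Ck k.+1 U f -> U x ->
  differentiable f x.
Proof.
move=> oU [_ fD] Ux; apply: (differentiable_partials oU Ux).
  by move=> i y; case: (fD i) => + _; exact.
by move=> i; case: (fD i) => _ /is_Ck_continuous; exact.
Qed.

Lemma is_Ck_cst k U (c : R) : is_Ck k U (fun=> c).
Proof.
elim: k c => [|k IH] c; first by split=> // x _; exact: cst_continuous.
split=> [x _|i]; first exact: cst_continuous.
split=> [x _|]; first exact: derivable_cst.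
rewrite (_ : 'D_(e_ i) _ = fun=> 0)//.
by apply/funext => x; exact: (derive_cst c).
Qed.

Lemma is_CkD k U f g : open U -> is_Ck k U f -> is_Ck k U g ->
  is_Ck k U (fun x => f x + g x).
Proof.
move=> oU; elim: k f g => [|k IH] f g [fc fD] [gc gD].
  by split=> // x Ux; apply: (@cvgD _ _ _ (nbhs x)); [exact: fc|exact: gc].
split=> [x Ux|i].
  by apply: (@cvgD _ _ _ (nbhs x)); [exact: fc|exact: gc].
have [df Df] := fD i; have [dg Dg] := gD i; split=> [x Ux|].
  by apply: derivableD; [exact: df|exact: dg].
apply: is_Ck_eq (IH _ _ Df Dg) => // x Ux.
by apply/esym/deriveD; [exact: df|exact: dg].
Qed.

Lemma is_CkM k U f g : open U -> is_Ck k U f -> is_Ck k U g ->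
  is_Ck k U (fun x => f x * g x).
Proof.
move=> oU; elim: k f g => [|k IH] f g fk gk.
  have [fc _] := fk; have [gc _] := gk; split=> // x Ux.
  by apply: (@cvgM _ _ (nbhs x)); [exact: fc|exact: gc].
have [fc fD] := fk; have [gc gD] := gk; split=> [x Ux|i].
  by apply: (@cvgM _ _ (nbhs x)); [exact: fc|exact: gc].
have [df Df] := fD i; have [dg Dg] := gD i; split=> [x Ux|].
  by apply: derivableM; [exact: df|exact: dg].
apply: (@is_Ck_eq _ _ (fun x => f x * 'D_(e_ i) g x + g x * 'D_(e_ i) f x)) => //.
  by move=> x Ux; apply/esym/deriveM; [exact: df|exact: dg].
by apply: is_CkD => //; apply: IH => //; exact: is_CkS.
Qed.

Lemma is_Ck_sum k U (I : Type) (r : seq I) (F : I -> E -> R) : open U ->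
  (forall i, is_Ck k U (F i)) -> is_Ck k U (fun x => \sum_(i <- r) F i x).
Proof.
move=> oU FU; elim: r => [|i r IH].
  by apply: is_Ck_eq (is_Ck_cst k U 0) => // x Ux; rewrite big_nil.
by apply: is_Ck_eq (is_CkD oU (FU i) IH) => // x Ux; rewrite big_cons.
Qed.

Lemma derive_coord i (x v : E) : 'D_v (fun y : E => y 0 i) x = v 0 i.
Proof.
have dI : derivable (id : E -> E) x v by exact: derivable_id.
by have := derive_mx dI; rewrite derive_id => /matrixP/(_ 0 i); rewrite !mxE => <-.
Qed.

Lemma is_Ck_coord k U i : is_Ck k U (fun x : E => x 0 i).
Proof.
have lin j : 'D_(e_ j) (fun x : E => x 0 i) = fun=> (i == j)%:R :> R.
  by apply/funext => x; rewrite derive_coord mxE eqxx.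
elim: k => [|k IH]; first by split=> // x _; exact: coord_continuous.
split=> [x _|j]; first exact: coord_continuous.
split=> [x _|]; first exact/diff_derivable/differentiable_coord.
rewrite lin; exact: is_Ck_cst.
Qed.

(** The function r = f^(-1/2) satisfies r' = - (1/2) r^3 f', which is polynomial
    in r and f'; so the order of differentiability of r is raised by induction. *)
Lemma is_Ck_rsqrt k U f : open U -> (forall x, U x -> 0 < f x) ->
  is_Ck k U f -> is_Ck k U (fun x => (Num.sqrt (f x))^-1).
Proof.
move=> oU f0.
have dr (y : R) : 0 < y ->
    is_derive y 1 (fun y => (Num.sqrt y)^-1) (- 2^-1 * (Num.sqrt y)^-1 ^+ 3).
  move=> y0; have s0 : Num.sqrt y != 0 by rewrite sqrtr_eq0 -ltNge.
  have ds := is_derive1_sqrt y0.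
  apply: is_derive_eq (is_deriveV s0 ds) _.
  by rewrite /GRing.scale/=; move: (Num.sqrt y) s0 => r r0; field.
have cf g x : {for x, continuous g} -> U x -> 0 < g x ->
    {for x, continuous (fun x => (Num.sqrt (g x))^-1)}.
  move=> gc Ux g0; apply: (@cvgV _ _ (nbhs x)); first by rewrite sqrtr_eq0 -ltNge.
  by apply: continuous_comp => //; exact: sqrt_continuous.
elim: k => [|k IH] fk.
  by split=> // x Ux; apply: cf => //; [exact: (is_Ck_continuous fk)|exact: f0].
split=> [x Ux|i].
  by apply: cf => //; [exact: (is_Ck_continuous fk)|exact: f0].
have DE x : U x -> is_derive x (e_ i) (fun x => (Num.sqrt (f x))^-1)
    (- 2^-1 * (Num.sqrt (f x))^-1 ^+ 3 * 'D_(e_ i) f x).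
  move=> Ux; apply: (@derive_comp1 _ _ f (fun y => (Num.sqrt y)^-1)); last exact/dr/f0.
  exact: (is_Ck_differentiable oU fk).
split=> [x Ux|]; first by case: (DE x Ux).
apply: (is_Ck_eq (f := fun x => - 2^-1 * (Num.sqrt (f x))^-1 ^+ 3 * 'D_(e_ i) f x)).
- by [].
- by move=> x Ux; have /@derive_val -> := DE x Ux.
have rk := IH (is_CkS fk).
apply: is_CkM => //; last by case: fk => _ /(_ i)[].
apply: is_CkM => //; first exact: is_Ck_cst.
by do 2 apply: is_CkM => //.
Qed.

End SmoothFunctions.

(** By the chain rule the partial derivatives of the composite are sums of
    products of functions to which the induction hypothesis applies. *)
Lemma is_Ck_comp (R : realType) m m' k (U : set 'rV[R]_m') (V : set 'rV[R]_m)
    f (F : 'rV[R]_m' -> 'rV[R]_m) : open U -> open V ->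
  (forall x, U x -> V (F x)) -> is_Ck k V f ->
  (forall j, is_Ck k U (fun x => F x 0 j)) -> is_Ck k U (fun x => f (F x)).
Proof.
move=> oU oV UV; elim: k f => [|k IH] f fk Fk.
  split=> // x Ux; apply: continuous_comp; last exact/(is_Ck_continuous fk)/UV.
  by apply: continuous_row => j; exact: (is_Ck_continuous (Fk j)).
split=> [x Ux|i].
  apply: continuous_comp; last exact/(is_Ck_continuous fk)/UV.
  by apply: continuous_row => j; exact: (is_Ck_continuous (Fk j)).
have DE x : U x -> is_derive x (delta_mx 0 i) (f \o F)
    (\sum_j 'D_(delta_mx 0 i) (fun y => F y 0 j) x * 'D_(delta_mx 0 j) f (F x)).
  move=> Ux; apply: derive_chain.
    by apply: (is_Ck_differentiable oV fk); exact: UV.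
  by move=> j; have [_ /(_ i)[+ _]] := Fk j; exact.
split=> [x Ux|]; first by case: (DE x Ux).
apply: (is_Ck_eq (f := fun x => \sum_j
  'D_(delta_mx 0 i) (fun y => F y 0 j) x * 'D_(delta_mx 0 j) f (F x))) => //.
  by move=> x Ux; have /@derive_val -> := DE x Ux.
apply: is_Ck_sum => // j; apply: is_CkM => //.
  by case: (Fk j) => _ /(_ i)[].
apply: (IH ('D_(delta_mx 0 j) f)); first by case: fk => _ /(_ j)[].
by move=> j'; exact: is_CkS.
Qed.

(** * Symmetry of second derivatives *)

Lemma dist_le_split (R : realFieldType) (a b c e : R) :
  `|c - a| < e / 2 -> `|c - b| < e / 2 -> `|b - a| <= e.
Proof.
rewrite !ltr_norml ler_norml => /andP[a1 a2] /andP[b1 b2].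
by apply/andP; split; lra.
Qed.

Section Schwarz.
Context {R : realType} {m : nat}.
Notation E := 'rV[R]_m.
Notation e_ i := (delta_mx (0 : 'I_1) i : E).
Implicit Types (f : E -> R) (U : set E).

Lemma norm_delta i : `|e_ i| <= 1.
Proof.
apply: rV_norm_le => // j; rewrite !mxE eqxx/=.
by case: eqP => _; rewrite ?normr1 ?normr0.
Qed.

(** The mean value theorem is applied to y |-> f(y + t e_j) - f(y) in the
    direction e_i, then to the partial derivative in the direction e_j.  The
    difference quotient on the right is symmetric in i and j. *)
Lemma second_difference f U x (i j : 'I_m) (d : R) (t : R) : 0 < t -> t + t < d ->
  (forall y, `|y - x| < d -> U y) -> is_Ck 2 U f -> open U ->
  exists2 y, `|y - x| < d &
    'D_(e_ j) ('D_(e_ i) f) y = (f (x + t *: e_ i + t *: e_ j)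
      - (f (x + t *: e_ i) + f (x + t *: e_ j)) + f x) / (t * t).
Proof.
move=> t0 td dU fk oU.
have near_x (s r : R) : `|s| <= `|t| -> `|r| <= `|t| ->
    `|(x + s *: e_ i + r *: e_ j) - x| < d.
  rewrite [`|t|]gtr0_norm// => st rt.
  rewrite -(addrA x) addrAC subrr add0r (le_lt_trans (ler_normD _ _))//.
  apply: le_lt_trans td; rewrite !normrZ.
  by apply: lerD; rewrite -[leRHS]mulr1; apply: ler_pM => //; exact: norm_delta.
have [fc fD] := fk; have [dfi Dfi] := fD i; have [_ Dfi'] := Dfi.
have [dfij _] := Dfi' j.
pose g y := f (y + t *: e_ j) - f y.
have gD y : U y -> U (y + t *: e_ j) ->
    is_derive y (e_ i) g ('D_(e_ i) f (y + t *: e_ j) - 'D_(e_ i) f y).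
  move=> Uy Uyt; apply: is_deriveB; last exact/derivableP/dfi.
  apply: eq_is_derive_growth (derivableP (dfi _ Uyt)) => h /=.
  by rewrite addrA.
have n0 : `|0 : R| <= `|t| by rewrite normr0.
have [s st|s st gE] := @mvt_line _ _ g x (e_ i) t.
  have [] // := gD (x + s *: e_ i).
    by apply: dU; have := near_x s 0 st n0; rewrite scale0r addr0.
  by apply: dU; exact: near_x.
have /@derive_val DgE := gD (x + s *: e_ i) ltac:(by apply: dU;
  have := near_x s 0 st n0; rewrite scale0r addr0)
  ltac:(by apply: dU; exact: near_x).
have [r rt|r rt DE] := @mvt_line _ _ ('D_(e_ i) f) (x + s *: e_ i) (e_ j) t.
  by apply/dfij/dU; exact: near_x.
exists (x + s *: e_ i + r *: e_ j); first exact: near_x.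
have <- : 'D_(e_ j) ('D_(e_ i) f) (x + s *: e_ i + r *: e_ j) * (t * t)
    = f (x + t *: e_ i + t *: e_ j) - (f (x + t *: e_ i) + f (x + t *: e_ j)) + f x.
  by rewrite mulrA -DE -DgE -gE /g; ring.
by rewrite mulfK// mulf_neq0// gt_eqF.
Qed.

Lemma schwarz f U x (i j : 'I_m) : open U -> U x -> is_Ck 2 U f ->
  'D_(e_ i) ('D_(e_ j) f) x = 'D_(e_ j) ('D_(e_ i) f) x.
Proof.
move=> oU Ux fk.
have [d0 d0p Hd0] := open_ball_in oU Ux.
have cont a b : {for x, continuous ('D_(e_ b) ('D_(e_ a) f))}.
  by case: fk => _ /(_ a)[_ [_ /(_ b)[_ [+ _]]]]; exact.
apply/eqP; rewrite -subr_eq0 -normr_le0; apply/ler_addgt0Pl => eps eps0.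
rewrite addr0.
have e2 : 0 < eps / 2 by rewrite divr_gt0.
have [d1 d1p H1] := continuous_ball (cont i j) e2.
have [d2 d2p H2] := continuous_ball (cont j i) e2.
pose d := Num.min d0 (Num.min d1 d2).
have dp : 0 < d by rewrite !lt_min d0p d1p d2p.
have t0 : 0 < d / 3 by rewrite divr_gt0.
(* with side d / 3 the whole square lies in the ball of radius d *)
have td : d / 3 + d / 3 < d by lra.
have dU y : `|y - x| < d -> U y.
  by rewrite lt_min => /andP[+ _]; exact: Hd0.
have [y yx yE] := second_difference i j t0 td dU fk oU.
have [z zx zE] := second_difference j i t0 td dU fk oU.
have yz : 'D_(e_ j) ('D_(e_ i) f) y = 'D_(e_ i) ('D_(e_ j) f) z.
  by rewrite yE zE [x + _ + _]addrAC [X in _ - X]addrC.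
move: yx zx; rewrite !lt_min => /and3P[_ y1 _] /and3P[_ _ z2].
by apply: dist_le_split (H1 _ y1) _; rewrite yz; exact: H2.
Qed.

End Schwarz.

(** * Closure properties of infinitely differentiable functions *)

Section Coo.
Context {R : realType} {m : nat}.
Notation E := 'rV[R]_m.
Implicit Types (f g : E -> R) (U V : set E).

Lemma is_Coo_eq U f g : open U -> (forall x, U x -> f x = g x) ->
  is_Coo U f -> is_Coo U g.
Proof. by move=> oU fg fU k; exact: is_Ck_eq (fU k). Qed.

Lemma is_Coo_sub U V f : (forall x, V x -> U x) -> is_Coo U f -> is_Coo V f.
Proof. by move=> VU fU k; exact: is_Ck_sub (fU k). Qed.

Lemma is_Coo_local U f : (forall x, U x -> exists V, V x /\ is_Coo V f) ->
  is_Coo U f.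
Proof.
move=> H k; apply: is_Ck_local => x Ux; have [V [Vx fV]] := H x Ux.
by exists V.
Qed.

Lemma is_Coo_differentiable U f x : open U -> is_Coo U f -> U x ->
  differentiable f x.
Proof. by move=> oU fU; exact: (is_Ck_differentiable oU (fU 1%N)). Qed.

Lemma is_Coo_cst U (c : R) : is_Coo U (fun=> c).
Proof. by move=> k; exact: is_Ck_cst. Qed.

Lemma is_Coo_coord U i : is_Coo U (fun x => x 0 i).
Proof. by move=> k; exact: is_Ck_coord. Qed.

Lemma is_CooD U f g : open U -> is_Coo U f -> is_Coo U g ->
  is_Coo U (fun x => f x + g x).
Proof. by move=> oU fU gU k; exact: is_CkD. Qed.

Lemma is_CooM U f g : open U -> is_Coo U f -> is_Coo U g ->
  is_Coo U (fun x => f x * g x).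
Proof. by move=> oU fU gU k; exact: is_CkM. Qed.

Lemma is_Coo_sum U (I : Type) (r : seq I) (F : I -> E -> R) : open U ->
  (forall i, is_Coo U (F i)) -> is_Coo U (fun x => \sum_(i <- r) F i x).
Proof. by move=> oU FU k; apply: is_Ck_sum => // i; exact: FU. Qed.

Lemma is_Coo_rsqrt U f : open U -> (forall x, U x -> 0 < f x) ->
  is_Coo U f -> is_Coo U (fun x => (Num.sqrt (f x))^-1).
Proof. by move=> oU f0 fU k; exact: is_Ck_rsqrt. Qed.

Lemma is_Coo_partial U f i : is_Coo U f -> is_Coo U ('D_(delta_mx 0 i) f).
Proof. by move=> fU k; case: (fU k.+1) => _ /(_ i)[]. Qed.

End Coo.

Lemma is_Coo_comp (R : realType) m m' (U : set 'rV[R]_m') (V : set 'rV[R]_m)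
    f (F : 'rV[R]_m' -> 'rV[R]_m) : open U -> open V ->
  (forall x, U x -> V (F x)) -> is_Coo V f ->
  (forall j, is_Coo U (fun x => F x 0 j)) -> is_Coo U (fun x => f (F x)).
Proof.
move=> oU oV UV fV FU k; apply: (is_Ck_comp oU oV UV (fV k)) => j.
exact: FU.
Qed.

(** * Smooth functions and directional derivatives on a manifold *)

Section SmoothOn.
Context {R : realType} {m : nat} {M : manifold R m}.
Notation e_ i := (delta_mx (0 : 'I_1) i).
Implicit Types (f g : M -> R) (U V W : set M) (c d : chart R m M).

Lemma chart_at_atlas (p : M) : atlas (chart_at p).
Proof. by have [] := projT2 (cid (atlas_cover p)). Qed.

Lemma chart_at_dom (p : M) : cdom (chart_at p) p.
Proof. by have [] := projT2 (cid (atlas_cover p)). Qed.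

Lemma open_cdom c : open (cdom c).
Proof. exact: cdom_open. Qed.

Lemma cmap_image c U p : U p -> cdom c p -> (cmap c @` (U `&` cdom c)) (cmap c p).
Proof. by move=> Up cp; exists p. Qed.

Lemma cmap_image_sub c U : U `<=` cdom c ->
  cmap c @` U = cmap c @` (U `&` cdom c).
Proof. by move=> UW; rewrite setIidl. Qed.

(** Openness of the image comes from the continuity of the inverse chart,
    because this image is the preimage of U within the image of the chart. *)
Lemma open_cmap_image c U : open U -> open (cmap c @` (U `&` cdom c)).
Proof.
move=> oU; rewrite openE => _ [p [Up cp] <-]; rewrite /interior.
have ip : (cmap c @` cdom c) (cmap c p) by exists p.
have nU : nbhs (cinv c (cmap c p)) (U : set M).
  by rewrite cmapK//; exact: open_nbhs_nbhs.
have := @cinv_continuous _ _ _ c _ ip _ nU.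
have := open_nbhs_nbhs (conj (@cimg_open _ _ _ c) ip).
apply: filterS2 => _ [q cq <-] Uq; exists q => //; split=> //.
by move: Uq; rewrite /= cmapK.
Qed.

Lemma smooth_on_sub U V f : V `<=` U -> smooth_on U f -> smooth_on V f.
Proof.
move=> VU fU c ac; apply: is_Coo_sub (fU c ac) => _ [p [Vp cp] <-].
by apply: cmap_image => //; exact: VU.
Qed.

Lemma smooth_on_eq U f g : open U -> (forall p, U p -> f p = g p) ->
  smooth_on U f -> smooth_on U g.
Proof.
move=> oU fg fU c ac; apply: is_Coo_eq (fU c ac); first exact: open_cmap_image.
by move=> _ [p [Up cp] <-]; rewrite cmapK// fg.
Qed.

Lemma smooth_on_local U f :
  (forall p, U p -> exists V, V p /\ smooth_on V f) -> smooth_on U f.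
Proof.
move=> H c ac; apply: is_Coo_local => _ [p [Up cp] <-].
have [V [Vp fV]] := H p Up; exists (cmap c @` (V `&` cdom c)).
by split; [exact: cmap_image|exact: fV].
Qed.

(** The transition maps are smooth, so smoothness in one chart around W
    implies smooth representations in all charts. *)
Lemma smooth_on_chart c W f : atlas c -> open W -> W `<=` cdom c ->
  is_Coo (cmap c @` W) (fun x => f (cinv c x)) -> smooth_on W f.
Proof.
move=> ac oW Wc fW d ad.
have oWd := @open_cmap_image d _ oW.
have oWc : open (cmap c @` W) by rewrite cmap_image_sub//; exact: open_cmap_image.
apply: (is_Coo_eq (f := fun x => f (cinv c (cmap c (cinv d x))))) => //.
  by move=> _ [p [Wp dp] <-]; rewrite cmapK// cmapK//; exact: Wc.
apply: (is_Coo_comp (F := fun x => cmap c (cinv d x)) oWd oWc _ fW).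
  by move=> _ [p [Wp dp] <-]; rewrite cmapK//; exists p.
move=> j; apply: is_Coo_sub (atlas_compatible ad ac j) => _ [p [Wp dp] <-].
by exists p => //; split=> //; exact: Wc.
Qed.

Lemma smooth_on_cst U (a : R) : smooth_on U (fun _ : M => a).
Proof. by move=> c _; exact: is_Coo_cst. Qed.

Lemma smooth_onD U f g : open U -> smooth_on U f -> smooth_on U g ->
  smooth_on U (fun p => f p + g p).
Proof.
move=> oU fU gU c ac; apply: is_CooD; [exact: open_cmap_image|exact: fU|exact: gU].
Qed.

Lemma smooth_onM U f g : open U -> smooth_on U f -> smooth_on U g ->
  smooth_on U (fun p => f p * g p).
Proof.
move=> oU fU gU c ac; apply: is_CooM; [exact: open_cmap_image|exact: fU|exact: gU].
Qed.

Lemma smooth_onN U f : open U -> smooth_on U f -> smooth_on U (fun p => - f p).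
Proof.
move=> oU fU; apply: smooth_on_eq (smooth_onM oU (smooth_on_cst U (-1)) fU) => //.
by move=> p _; rewrite mulN1r.
Qed.

Lemma smooth_onB U f g : open U -> smooth_on U f -> smooth_on U g ->
  smooth_on U (fun p => f p - g p).
Proof. by move=> oU fU gU; apply: smooth_onD => //; exact: smooth_onN. Qed.

Lemma smooth_on_sum U (I : Type) (r : seq I) (F : I -> M -> R) : open U ->
  (forall i, smooth_on U (F i)) -> smooth_on U (fun p => \sum_(i <- r) F i p).
Proof.
move=> oU FU c ac; apply: is_Coo_sum => [|i]; first exact: open_cmap_image.
exact: FU.
Qed.

Lemma smooth_on_rsqrt U f : open U -> (forall p, U p -> 0 < f p) ->
  smooth_on U f -> smooth_on U (fun p => (Num.sqrt (f p))^-1).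
Proof.
move=> oU f0 fU c ac; apply: is_Coo_rsqrt; [exact: open_cmap_image| |exact: fU].
by move=> _ [p [Up cp] <-]; rewrite cmapK//; exact: f0.
Qed.

Lemma smooth_on_coord c i : atlas c -> smooth_on (cdom c) (fun q => cmap c q 0 i).
Proof.
move=> ac; apply: (smooth_on_chart ac) => //; first exact: open_cdom.
apply: (is_Coo_eq (f := fun x => x 0 i)); last exact: is_Coo_coord.
  exact: cimg_open.
by move=> _ [p cp <-]; rewrite cmapK.
Qed.

Lemma smooth_on_continuous U f p : open U -> U p -> smooth_on U f ->
  {for p, continuous f}.
Proof.
move=> oU Up fU; pose c := chart_at p.
have ac := chart_at_atlas p; have cp := chart_at_dom p; rewrite -/c in ac cp.
have fc : {for p, continuous ((fun x => f (cinv c x)) \o cmap c)}.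
  apply: continuous_comp; first exact: cmap_continuous.
  exact: (is_Ck_continuous (fU c ac 0%N) (cmap_image Up cp)).
move: fc; rewrite /prop_for /continuous_at /= cmapK//; apply: cvg_trans.
apply: (@near_eq_cvg _ _ (nbhs p)).
apply: filterS (open_nbhs_nbhs (conj (open_cdom c) cp)) => q cq /=.
by rewrite cmapK.
Qed.

End SmoothOn.

#[global] Hint Resolve chart_at_atlas chart_at_dom open_cdom : core.

Section DirectionalDerivative.
Context {R : realType} {m : nat} {M : manifold R m}.
Notation e_ i := (delta_mx (0 : 'I_1) i).
Implicit Types (f g : M -> R) (U V W : set M) (c d : chart R m M) (X Y : vfield M).

Lemma smooth_on_differentiable U f c p : atlas c -> open U -> smooth_on U f ->
  U p -> cdom c p -> differentiable (fun x => f (cinv c x)) (cmap c p).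
Proof.
move=> ac oU fU Up cp; apply: (is_Coo_differentiable (open_cmap_image oU) (fU c ac)).
exact: cmap_image.
Qed.

(** This is the chain rule along the transition map from c to d. *)
Lemma derive_change_chart U f c d p (v : 'rV[R]_m) : atlas c -> atlas d ->
  open U -> smooth_on U f -> U p -> cdom c p -> cdom d p ->
  'D_v (fun x => f (cinv c x)) (cmap c p) =
  \sum_j 'D_v (fun x => cmap d (cinv c x) 0 j) (cmap c p) *
         'D_(e_ j) (fun x => f (cinv d x)) (cmap d p) :> R.
Proof.
move=> ac ad oU fU Up cp dp.
pose F x := cmap d (cinv c x).
have Fp : F (cmap c p) = cmap d p by rewrite /F cmapK.
have dF j : derivable (fun x => F x 0 j) (cmap c p) v.
  apply: diff_derivable.
  exact: (smooth_on_differentiable ac (open_cdom d) (smooth_on_coord j ad)).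
have df : differentiable (fun x => f (cinv d x)) (F (cmap c p)).
  by rewrite Fp; exact: smooth_on_differentiable fU Up dp.
have := @derive_val _ _ _ _ _ _ _ (derive_chain df dF); rewrite Fp => <-.
apply: near_eq_derive.
apply: (open_near (open_cmap_image (U := U `&` cdom d) _)).
- by apply: openI => //; exact: open_cdom.
- by apply: cmap_image.
- by move=> _ [q [[Uq dq] cq] <-]; rewrite /= /F !cmapK.
Qed.

(** The vector X p is given by its components in the preferred chart at p;
    this formula computes X(f) in any chart, through the components X(x^j). *)
Lemma dirder_chart U f c p X : atlas c -> open U -> smooth_on U f -> U p ->
  cdom c p ->
  dirder X f p = \sum_j dirder X (fun q => cmap c q 0 j) p *
                   'D_(e_ j) (fun x => f (cinv c x)) (cmap c p) :> R.
Proof. by move=> ac oU fU Up cp; exact: derive_change_chart oU fU Up _ _. Qed.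

Lemma dirder_near U f g p X : open U -> U p -> (forall q, U q -> f q = g q) ->
  dirder X f p = dirder X g p.
Proof.
move=> oU Up fg; apply: near_eq_derive.
apply: (open_near (open_cmap_image (c := chart_at p) oU)); first exact: cmap_image.
by move=> _ [q [Uq cq] <-]; rewrite !cmapK// fg.
Qed.

Lemma dirder_vec X Y f p : X p = Y p -> dirder X f p = dirder Y f p.
Proof. by rewrite /dirder => ->. Qed.

Lemma dirder_cst p X (a : R) : dirder X (fun=> a) p = 0.
Proof. exact: (derive_cst a). Qed.

Lemma dirderD U f g p X : open U -> U p -> smooth_on U f -> smooth_on U g ->
  dirder X (fun q => f q + g q) p = dirder X f p + dirder X g p.
Proof.
move=> oU Up fU gU; have ac := chart_at_atlas p; have cp := chart_at_dom p.
by apply: deriveD; apply: diff_derivable;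
  [exact: smooth_on_differentiable fU Up cp|exact: smooth_on_differentiable gU Up cp].
Qed.

Lemma dirderM U f g p X : open U -> U p -> smooth_on U f -> smooth_on U g ->
  dirder X (fun q => f q * g q) p = dirder X f p * g p + f p * dirder X g p.
Proof.
move=> oU Up fU gU; have ac := chart_at_atlas p; have cp := chart_at_dom p.
have := @deriveM R _ (fun x => f (cinv (chart_at p) x))
  (fun x => g (cinv (chart_at p) x)) (cmap (chart_at p) p) (X p).
rewrite cmapK// => H; rewrite addrC [_ * g p]mulrC.
by apply: H; apply: diff_derivable;
  [exact: smooth_on_differentiable fU Up cp|exact: smooth_on_differentiable gU Up cp].
Qed.

Lemma dirderN U f p X : open U -> U p -> smooth_on U f ->
  dirder X (fun q => - f q) p = - dirder X f p.
Proof.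
move=> oU Up fU; have ac := chart_at_atlas p; have cp := chart_at_dom p.
by apply: deriveN; apply: diff_derivable; exact: smooth_on_differentiable fU Up cp.
Qed.

Lemma dirderB U f g p X : open U -> U p -> smooth_on U f -> smooth_on U g ->
  dirder X (fun q => f q - g q) p = dirder X f p - dirder X g p.
Proof.
move=> oU Up fU gU; rewrite (dirderD _ oU Up fU (smooth_onN oU gU)).
by rewrite (dirderN _ oU Up gU).
Qed.

Lemma dirder_sum U (I : Type) (r : seq I) (F : I -> M -> R) p X : open U -> U p ->
  (forall i, smooth_on U (F i)) ->
  dirder X (fun q => \sum_(i <- r) F i q) p = \sum_(i <- r) dirder X (F i) p.
Proof.
move=> oU Up FU; elim: r => [|i r IH].
  rewrite big_nil -[RHS](dirder_cst p X 0); apply: (dirder_near _ oU Up) => q _.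
  by rewrite big_nil.
rewrite big_cons -IH -(dirderD _ oU Up (FU i)); last exact: smooth_on_sum.
by apply: (dirder_near _ oU Up) => q _; rewrite big_cons.
Qed.

Lemma dirder_linear U f p : open U -> U p -> smooth_on U f ->
  scalar (fun v : 'rV[R]_m => dirder (fun _ => v) f p).
Proof.
move=> oU Up fU a u v; have ac := chart_at_atlas p; have cp := chart_at_dom p.
have df := smooth_on_differentiable ac oU fU Up cp.
by rewrite /dirder !deriveE//= linearP.
Qed.

Lemma dirder_coord p X i : dirder X (fun q => cmap (chart_at p) q 0 i) p = X p 0 i.
Proof.
rewrite /dirder -[RHS](derive_coord i (cmap (chart_at p) p)).
apply: near_eq_derive; apply: (open_near (@cimg_open _ _ _ (chart_at p))).
  by exists p.
by move=> _ [q cq <-]; rewrite cmapK.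
Qed.

End DirectionalDerivative.

(** * Vector fields and the Lie bracket *)

Section Fields.
Context {R : realType} {m : nat} {M : manifold R m}.
Notation e_ i := (delta_mx (0 : 'I_1) i).
Implicit Types (f g : M -> R) (U V W : set M) (c d : chart R m M) (X Y Z : vfield M).

Lemma dirder_fieldD U f p X Y : open U -> U p -> smooth_on U f ->
  dirder (fun q => X q + Y q) f p = dirder X f p + dirder Y f p.
Proof.
move=> oU Up fU; have /(_ 1 (X p) (Y p)) := dirder_linear oU Up fU.
by rewrite scale1r mul1r.
Qed.

Lemma dirder_fieldZ U f p X (a : M -> R) : open U -> U p -> smooth_on U f ->
  dirder (fun q => a q *: X q) f p = a p * dirder X f p.
Proof.
move=> oU Up fU; have := dirder_linear oU Up fU (a p) (X p) 0.
by rewrite addr0 [X in _ = _ + X](derive0) addr0.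
Qed.

Lemma smooth_field_chart U X c i : smooth_field U X -> atlas c ->
  is_Coo (cmap c @` (U `&` cdom c)) (fun x => dirder X (fun q => cmap c q 0 i) (cinv c x)).
Proof.
by move=> XU ac; have := XU c ac i c ac; rewrite -setIA setIid.
Qed.

Lemma smooth_field_sub U V X : V `<=` U -> smooth_field U X -> smooth_field V X.
Proof.
move=> VU XU c ac i; apply: smooth_on_sub (XU c ac i) => p [Vp cp].
by split=> //; exact: VU.
Qed.

Lemma smooth_field_eq U X Y : open U -> (forall p, U p -> X p = Y p) ->
  smooth_field U X -> smooth_field U Y.
Proof.
move=> oU XY XU c ac i; apply: smooth_on_eq (XU c ac i); first exact: openI.
by move=> p [Up cp]; rewrite /dirder XY.
Qed.

Lemma smooth_field_local U X :
  (forall p, U p -> exists V, V p /\ smooth_field V X) -> smooth_field U X.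
Proof.
move=> H c ac i; apply: smooth_on_local => p [Up cp].
have [V [Vp XV]] := H p Up; exists (V `&` cdom c); split=> //; exact: XV.
Qed.

Lemma smooth_fieldD U X Y : open U -> smooth_field U X -> smooth_field U Y ->
  smooth_field U (fun p => X p + Y p).
Proof.
move=> oU XU YU c ac i; have oUc : open (U `&` cdom c) by exact: openI.
apply: smooth_on_eq (smooth_onD oUc (XU c ac i) (YU c ac i)) => // p [Up cp].
by rewrite (dirder_fieldD _ _ (open_cdom c) cp (smooth_on_coord i ac)).
Qed.

Lemma smooth_fieldZ U (a : M -> R) X : open U -> smooth_on U a -> smooth_field U X ->
  smooth_field U (fun p => a p *: X p).
Proof.
move=> oU aU XU c ac i; have oUc : open (U `&` cdom c) by exact: openI.
have aUc : smooth_on (U `&` cdom c) a by apply: smooth_on_sub aU => p [].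
apply: smooth_on_eq (smooth_onM oUc aUc (XU c ac i)) => // p [Up cp].
by rewrite (dirder_fieldZ _ _ (open_cdom c) cp (smooth_on_coord i ac)).
Qed.

Lemma smooth_fieldN U X : open U -> smooth_field U X ->
  smooth_field U (fun p => - X p).
Proof.
move=> oU XU; apply: smooth_field_eq (smooth_fieldZ oU (smooth_on_cst U (-1)) XU) => //.
by move=> p _; rewrite scaleN1r.
Qed.

Lemma smooth_fieldB U X Y : open U -> smooth_field U X -> smooth_field U Y ->
  smooth_field U (fun p => X p - Y p).
Proof.
by move=> oU XU YU; exact: (smooth_fieldD oU XU (smooth_fieldN oU YU)).
Qed.

Lemma smooth_field0 U : open U -> smooth_field U (fun _ : M => 0).
Proof.
move=> oU c ac i; apply: smooth_on_eq (smooth_on_cst _ 0).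
  exact: openI.
move=> p _; apply/esym; rewrite /dirder; exact: derive0.
Qed.

Lemma smooth_field_sum U (I : Type) (r : seq I) (F : I -> vfield M) : open U ->
  (forall i, smooth_field U (F i)) -> smooth_field U (fun p => \sum_(i <- r) F i p).
Proof.
move=> oU FU; elim: r => [|i r IH].
  by apply: smooth_field_eq (smooth_field0 oU) => // p _; rewrite big_nil.
by apply: smooth_field_eq (smooth_fieldD oU (FU i) IH) => // p _; rewrite big_cons.
Qed.

(** In a chart c around a point, X(f) is the sum of the X(x^j) times the partial
    derivatives of f read in c. *)
Lemma smooth_dirder U X f : open U -> smooth_field U X -> smooth_on U f ->
  smooth_on U (dirder X f).
Proof.
move=> oU XU fU; apply: smooth_on_local => p Up; pose c := chart_at p.
have ac : atlas c := chart_at_atlas p; have cp : cdom c p := chart_at_dom p.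
exists (U `&` cdom c); split=> //.
apply: (smooth_on_chart ac); [exact: openI|by move=> q []|].
have oW := open_cmap_image (c := c) oU.
apply: (is_Coo_eq (f := fun x => \sum_j dirder X (fun q => cmap c q 0 j) (cinv c x) *
   'D_(e_ j) (fun x => f (cinv c x)) x)) => //.
  by move=> _ [q [Uq cq] <-]; rewrite cmapK// (dirder_chart _ ac oU fU Uq cq).
apply: is_Coo_sum => // j; apply: is_CooM => //; first exact: smooth_field_chart.
exact: is_Coo_partial (fU c ac).
Qed.

(** This is the coordinate field of index j of the chart c: its components at q
    are a column of the Jacobian matrix of the transition map from c to the
    preferred chart at q. *)
Definition coord_field c j : vfield M := fun q =>
  \row_i 'D_(e_ j) (fun x => cmap (chart_at q) (cinv c x) 0 i) (cmap c q).

Lemma dirder_coord_field U c j f p : atlas c -> open U -> smooth_on U f -> U p ->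
  cdom c p ->
  dirder (coord_field c j) f p = 'D_(e_ j) (fun x => f (cinv c x)) (cmap c p).
Proof.
move=> ac oU fU Up cp.
rewrite (derive_change_chart _ ac (chart_at_atlas p) oU fU Up cp (chart_at_dom p)).
rewrite (dirder_chart _ (chart_at_atlas p) oU fU Up (chart_at_dom p)).
by apply: eq_bigr => i _; rewrite dirder_coord mxE.
Qed.

Lemma smooth_coord_field c j : atlas c -> smooth_field (cdom c) (coord_field c j).
Proof.
move=> ac d ad i; apply: (smooth_on_chart ac); first exact: openI.
  by move=> q [].
have oW : open (cmap c @` (cdom c `&` cdom d)).
  by rewrite setIC; exact: open_cmap_image.
apply: (is_Coo_eq (f := 'D_(e_ j) (fun x => cmap d (cinv c x) 0 i))) => //.
  move=> _ [q [cq dq] <-]; rewrite cmapK//.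
  by rewrite (dirder_coord_field _ ac (open_cdom d) (smooth_on_coord i ad)).
apply: is_Coo_partial; exact: atlas_compatible.
Qed.

Lemma coord_field_self p j : coord_field (chart_at p) j p = e_ j.
Proof.
apply/rowP => i; rewrite mxE -(derive_coord i (cmap (chart_at p) p)).
apply: near_eq_derive; apply: (open_near (@cimg_open _ _ _ (chart_at p))).
  by exists p.
by move=> _ [q cq <-]; rewrite cmapK.
Qed.

(** The field has constant coefficients in the preferred chart at p.  It reduces
    identities between vectors at p to identities between smooth fields. *)
Lemma exists_field p (v : 'rV[R]_m) :
  exists X, smooth_field (cdom (chart_at p)) X /\ X p = v.
Proof.
exists (fun q => \sum_j v 0 j *: coord_field (chart_at p) j q); split.
  apply: smooth_field_sum => // j; apply: smooth_fieldZ => //.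
    exact: smooth_on_cst.
  exact: smooth_coord_field.
by rewrite [RHS]row_sum_delta; apply: eq_bigr => j _; rewrite coord_field_self.
Qed.

(** In coordinates, X(Y f) is the sum of the X(Y^i) d_i f and of the
    Y^i X^j d_j d_i f.  By the symmetry of second derivatives the second order
    terms cancel in the commutator, and the first order terms are those of the
    bracket. *)
Lemma bracketE U X Y f p : open U -> U p -> smooth_field U X -> smooth_field U Y ->
  smooth_on U f ->
  dirder (bracket X Y) f p = dirder X (dirder Y f) p - dirder Y (dirder X f) p.
Proof.
move=> oU Up XU YU fU; pose c := chart_at p.
have ac : atlas c := chart_at_atlas p; have cp : cdom c p := chart_at_dom p.
pose W := U `&` cdom c; have oW : open W by exact: openI.
have Wp : W p by [].
have fW : smooth_on W f by apply: smooth_on_sub fU => q [].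
pose x_ i q := cmap c q 0 i.
pose P i q := 'D_(e_ i) (fun x => f (cinv c x)) (cmap c q) : R.
have PW i : smooth_on W (P i).
  apply: (smooth_on_chart ac) => //; first by move=> q [].
  apply: is_Coo_eq (is_Coo_partial i (fU c ac)); first exact: open_cmap_image.
  by move=> _ [q [Uq cq] <-]; rewrite /P cmapK.
pose S i j : R := 'D_(e_ j) ('D_(e_ i) (fun x => f (cinv c x))) (cmap c p).
have SC i j : S i j = S j i.
  exact: (schwarz j i (open_cmap_image oU) (cmap_image Up cp) (fU c ac 2%N)).
have PS i j : 'D_(e_ j) (fun x => P i (cinv c x)) (cmap c p) = S i j.
  apply: near_eq_derive; apply: (open_near (open_cmap_image (c := c) oU)).
    exact: cmap_image.
  by move=> _ [q [Uq cq] <-]; rewrite /P cmapK.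
have second Y' X' : smooth_field U X' -> smooth_field U Y' ->
    dirder X' (dirder Y' f) p = \sum_i dirder X' (dirder Y' (x_ i)) p * P i p
      + \sum_i \sum_j dirder Y' (x_ i) p * dirder X' (x_ j) p * S i j.
  move=> XU' YU'.
  have YW i : smooth_on W (dirder Y' (x_ i)) by exact: YU'.
  have -> : dirder X' (dirder Y' f) p
      = dirder X' (fun q => \sum_i dirder Y' (x_ i) q * P i q) p.
    apply: (dirder_near _ oW Wp) => q [Uq cq].
    exact: (dirder_chart _ ac oU fU Uq cq).
  rewrite (dirder_sum _ _ oW Wp); last by move=> i; exact: smooth_onM.
  rewrite -big_split/=; apply: eq_bigr => i _.
  rewrite (dirderM _ oW Wp (YW i) (PW i)); congr (_ + _).
  rewrite (dirder_chart _ ac oW (PW i) Wp cp) mulr_sumr; apply: eq_bigr => j _.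
  by rewrite PS mulrA.
have [eXY eYX] := (second Y X XU YU, second X Y YU XU).
apply: etrans (esym (congr2 (fun a b => a - b) eXY eYX)).
rewrite (dirder_chart _ ac oU fU Up cp).
rewrite [X in _ = _ + X - _]exchange_big/= opprD addrACA -sumrB -sumrB.
rewrite [X in _ + X]big1 ?addr0.
  apply: eq_bigr => i _; rewrite dirder_coord mxE.
  by rewrite -mulrBl.
by move=> j _; rewrite -sumrB big1// => i _; rewrite (SC i j) [X in X * _]mulrC subrr.
Qed.

(** The components of the bracket in a chart are commutators of derivations
    applied to the coordinates, thus smooth. *)
Lemma smooth_bracket U X Y : open U -> smooth_field U X -> smooth_field U Y ->
  smooth_field U (bracket X Y).
Proof.
move=> oU XU YU c ac i.
have oW : open (U `&` cdom c) by exact: openI.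
have XW : smooth_field (U `&` cdom c) X by apply: smooth_field_sub XU => q [].
have YW : smooth_field (U `&` cdom c) Y by apply: smooth_field_sub YU => q [].
have xW : smooth_on (U `&` cdom c) (fun q => cmap c q 0 i).
  by apply: smooth_on_sub (smooth_on_coord i ac) => q [].
have := smooth_onB oW (smooth_dirder oW XW (smooth_dirder oW YW xW))
                      (smooth_dirder oW YW (smooth_dirder oW XW xW)).
apply: smooth_on_eq => // q Wq.
by rewrite (bracketE oW Wq XW YW xW).
Qed.

(** A vector is determined by its action on smooth functions, since its
    components are obtained from the coordinates. *)
Lemma vfield_eq p U X Y : open U -> U p ->
  (forall V f, open V -> V p -> V `<=` U -> smooth_on V f ->
    dirder X f p = dirder Y f p) -> X p = Y p.
Proof.
move=> oU Up XY; apply/rowP => i; rewrite -!dirder_coord.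
apply: (XY (U `&` cdom (chart_at p))); first exact: openI.
- by split.
- by move=> q [].
- by apply: smooth_on_sub (smooth_on_coord i (chart_at_atlas p)) => q [].
Qed.

Lemma bracket_anti X Y p : bracket X Y p = - bracket Y X p.
Proof. by apply/rowP => i; rewrite !mxE opprB. Qed.

(** Here xyz stands for X(Y(Z f)), and a, a', b, b', c, c' for the terms of the
    Jacobi identity applied to f. *)
Lemma jacobi_sum (xyz xzy yzx zyx yxz zxy a a' b b' c c' : R) :
  a = xyz - xzy -> a' = yzx - zyx -> b = xyz - yxz -> b' = zxy - zyx ->
  c = yxz - yzx -> c' = xzy - zxy -> a - a' = (b - b') + (c - c').
Proof. by move=> -> -> -> -> -> ->; ring. Qed.

(** Both sides act on functions as the same combination of the six triple
    products of the derivations X, Y and Z. *)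
Lemma jacobi U X Y Z p : open U -> U p -> smooth_field U X -> smooth_field U Y ->
  smooth_field U Z ->
  bracket X (bracket Y Z) p = bracket (bracket X Y) Z p + bracket Y (bracket X Z) p.
Proof.
move=> oU Up XU YU ZU.
apply: (vfield_eq (Y := fun q => bracket (bracket X Y) Z q + bracket Y (bracket X Z) q)
  oU Up) => V f oV Vp VU fV.
have XV := smooth_field_sub VU XU; have YV := smooth_field_sub VU YU.
have ZV := smooth_field_sub VU ZU.
have bE A B g q : smooth_field V A -> smooth_field V B -> smooth_on V g -> V q ->
    dirder (bracket A B) g q = dirder A (dirder B g) q - dirder B (dirder A g) q.
  by move=> AV BV gV Vq; exact: bracketE gV.
have bS A B := @smooth_bracket V A B oV.
have dS A g := @smooth_dirder V A g oV.
have bb A B C : smooth_field V A -> smooth_field V B -> smooth_field V C ->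
    dirder A (dirder (bracket B C) f) p
      = dirder A (dirder B (dirder C f)) p - dirder A (dirder C (dirder B f)) p.
  move=> AV BV CV; have [fB fC] := (dS B f BV fV, dS C f CV fV).
  apply: etrans (dirderB A oV Vp (dS _ _ BV fC) (dS _ _ CV fB)).
  by apply: (dirder_near _ oV Vp) => q Vq; exact: bE.
rewrite (dirder_fieldD _ _ oV Vp fV).
have e1 := bE X (bracket Y Z) f p XV (bS _ _ YV ZV) fV Vp.
have e2 := bE (bracket X Y) Z f p (bS _ _ XV YV) ZV fV Vp.
have e3 := bE Y (bracket X Z) f p YV (bS _ _ XV ZV) fV Vp.
apply: etrans e1 (etrans _ (esym (congr2 +%R e2 e3))).
have [fX [fY fZ]] := (dS X f XV fV, (dS Y f YV fV, dS Z f ZV fV)).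
exact: jacobi_sum (bb X Y Z XV YV ZV) (bE Y Z _ p YV ZV fX Vp)
  (bE X Y _ p XV YV fZ Vp) (bb Z X Y ZV XV YV) (bb Y X Z YV XV ZV)
  (bE X Z _ p XV ZV fY Vp).
Qed.

End Fields.

(** * Riemannian metrics, orthonormal frames and gradients *)

Section Metric.
Context {R : realType} {m : nat} {M : manifold R m} (g : riemannian_metric M).
Implicit Types (f : M -> R) (U V W : set M) (X Y Z : vfield M).

Lemma metricC p u v : g p u v = g p v u.
Proof. exact: Defs.metric_sym. Qed.

Lemma metric_gt0 p u : u != 0 -> 0 < g p u u.
Proof. exact: Defs.metric_pos. Qed.

Lemma metricDr p u v w : g p u (v + w) = g p u v + g p u w.
Proof. by have := metric_linear g p u 1 v w; rewrite scale1r mul1r. Qed.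

Lemma metric0r p u : g p u 0 = 0.
Proof. by apply: (addrI (g p u 0)); rewrite -metricDr !addr0. Qed.

Lemma metricZr p u a v : g p u (a *: v) = a * g p u v.
Proof. by have := metric_linear g p u a v 0; rewrite metric0r !addr0. Qed.

Lemma metricNr p u v : g p u (- v) = - g p u v.
Proof. by rewrite -scaleN1r metricZr mulN1r. Qed.

Lemma metricBr p u v w : g p u (v - w) = g p u v - g p u w.
Proof. by rewrite metricDr metricNr. Qed.

Lemma metricDl p u v w : g p (u + v) w = g p u w + g p v w.
Proof. by rewrite metricC metricDr !(metricC p w). Qed.

Lemma metricZl p a u v : g p (a *: u) v = a * g p u v.
Proof. by rewrite metricC metricZr metricC. Qed.

Lemma metricNl p u v : g p (- u) v = - g p u v.
Proof. by rewrite metricC metricNr metricC. Qed.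

Lemma metricBl p u v w : g p (u - v) w = g p u w - g p v w.
Proof. by rewrite metricDl metricNl. Qed.

Lemma metric_suml p (I : Type) (r : seq I) (F : I -> 'rV[R]_m) v :
  g p (\sum_(i <- r) F i) v = \sum_(i <- r) g p (F i) v.
Proof.
elim: r => [|i r IH]; last by rewrite !big_cons metricDl IH.
by rewrite !big_nil metricC metric0r.
Qed.

Lemma metric_eq p u v : (forall w, g p u w = g p v w) -> u = v.
Proof.
move=> uv; apply/eqP; rewrite -subr_eq0; apply: contraT => /(metric_gt0 p).
by rewrite metricBl uv subrr ltxx.
Qed.

(** The values at p of local smooth fields exhaust the tangent space, so they
    suffice to identify a vector by scalar products. *)
Lemma metric_eq_fields U p u v : open U -> U p ->
  (forall V Z, open V -> V p -> V `<=` U -> smooth_field V Z ->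
    g p u (Z p) = g p v (Z p)) -> u = v.
Proof.
move=> oU Up uv; apply: metric_eq => w; have [Z [ZU <-]] := exists_field p w.
have WU : U `&` cdom (chart_at p) `<=` U by move=> q [].
apply: (uv _ _ _ _ WU); [exact: openI|by split|].
by apply: smooth_field_sub ZU => q [].
Qed.

(** The matrix whose rows are the e i is invertible, because the scalar product
    with e j recovers the j-th coefficient of a linear combination. *)
Lemma orthonormal_expansion p (e : 'I_m -> 'rV[R]_m) :
  (forall i j, g p (e i) (e j) = (i == j)%:R) ->
  forall u, u = \sum_i g p u (e i) *: e i.
Proof.
move=> ge u; pose A : 'M[R]_m := \matrix_i e i.
have mulA (c : 'rV[R]_m) : c *m A = \sum_i c 0 i *: e i.
  by rewrite mulmx_sum_row; apply: eq_bigr => i _; rewrite rowK.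
have gA (c : 'rV[R]_m) j : g p (c *m A) (e j) = c 0 j.
  rewrite mulA metric_suml (bigD1 j)//= metricZl ge eqxx mulr1 big1 ?addr0//.
  by move=> i ij; rewrite metricZl ge (negbTE ij) mulr0.
have fA : row_free A.
  rewrite -kermx_eq0; apply/rowV0P => c /sub_kermxP cA.
  by apply/rowP => j; rewrite -gA cA mxE metricC metric0r.
have uA : A \in unitmx by rewrite -row_free_unit.
have -> : u = u *m invmx A *m A by rewrite mulmxKV.
by rewrite [LHS]mulA; apply: eq_bigr => i _; rewrite gA.
Qed.

(** The orthogonality conditions are k linear equations in m > k unknowns. *)
Lemma exists_orthogonal p k (e : nat -> 'rV[R]_m) : (k < m)%N ->
  exists2 v, v != 0 & forall i, (i < k)%N -> g p v (e i) = 0.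
Proof.
move=> km; pose B : 'M[R]_(m, k) := \matrix_(a, i) g p (delta_mx 0 a) (e i).
have : kermx B != 0.
  rewrite -mxrank_eq0 mxrank_ker -lt0n subn_gt0.
  exact: leq_ltn_trans (rank_leq_col B) km.
move=> /rowV0Pn[v /sub_kermxP vB v0]; exists v => // i ik.
have /rowP/(_ (Ordinal ik)) := vB; rewrite !mxE => <-.
rewrite {1}[v]row_sum_delta metric_suml; apply: eq_bigr => a _.
by rewrite metricZl mxE.
Qed.

Lemma smooth_metric U X Y : open U -> smooth_field U X -> smooth_field U Y ->
  smooth_on U (fun p => g p (X p) (Y p)).
Proof. exact: metric_smooth. Qed.

(** This is the Gram-Schmidt process on fields, one field at a time.  A nonzero
    vector orthogonal at p to the fields already found is extended to a smooth
    field, which is then made orthogonal to these fields.  The value at p does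
    not change, so the new field is nonzero near p and can be normalised there,
    on a smaller open set. *)
Lemma exists_partial_frame p k : (k <= m)%N ->
  exists U (e : nat -> vfield M), [/\ open U, U p,
    forall i, (i < k)%N -> smooth_field U (e i) &
    forall q, U q -> forall i j, (i < k)%N -> (j < k)%N ->
      g q (e i q) (e j q) = (i == j)%:R].
Proof.
elim: k => [_|k IH km].
  (* there is no condition on the fields when k = 0 *)
  by exists setT, (fun _ _ => 0); split=> //; exact: openT.
have [U0 [e [oU0 U0p e_smooth e_orth]]] := IH (ltnW km).
have [v v0 ve] := exists_orthogonal p (fun i => e i p) km.
have [X [XU Xp]] := exists_field p v.
pose U1 := U0 `&` cdom (chart_at p).
have oU1 : open U1 by exact: openI.
have U1p : U1 p by split.
have eU1 i : (i < k)%N -> smooth_field U1 (e i).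
  by move=> ik; apply: smooth_field_sub (e_smooth i ik) => q [].
have XU1 : smooth_field U1 X by apply: smooth_field_sub XU => q [].
pose W q := X q - \sum_(i < k) g q (X q) (e i q) *: e i q.
have WU1 : smooth_field U1 W.
  apply: (smooth_fieldB oU1 XU1); apply: (smooth_field_sum _ oU1) => i.
  have ei := eU1 i (ltn_ord i).
  exact: (smooth_fieldZ oU1 (smooth_metric oU1 XU1 ei) ei).
have We q j : U1 q -> (j < k)%N -> g q (W q) (e j q) = 0.
  move=> [U0q _] jk; rewrite /W metricBl metric_suml (bigD1 (Ordinal jk))//=.
  rewrite metricZl e_orth// eqxx mulr1 big1 ?addr0 ?subrr// => i ij.
  rewrite metricZl e_orth// (_ : (i : nat) == j = false) ?mulr0//.
  by apply/negbTE.
have Wp : W p = v.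
  rewrite /W Xp big1 ?subr0// => i _.
  by rewrite ve// scale0r.
pose h q := g q (W q) (W q).
have hU1 : smooth_on U1 h by exact: smooth_metric.
have hp : 0 < h p by rewrite /h Wp; exact: metric_gt0.
pose U := U1 `&` interior [set q | 0 < h q].
have oU : open U by apply: openI => //; exact: open_interior.
have hU q : U q -> 0 < h q by move=> [_ /interior_subset].
have UU1 : U `<=` U1 by move=> q [].
exists U, (fun i q => if (i < k)%N then e i q else (Num.sqrt (h q))^-1 *: W q).
split; first exact: oU.
- split; first exact: U1p.
  have hc := smooth_on_continuous oU1 U1p hU1.
  by have /= := hc [set x | 0 < x] (open_nbhs_nbhs (conj (@open_gt _ 0) hp)).
- move=> i _; case: (i < k)%N (eU1 i) => [/(_ isT) ei|_].
    exact: smooth_field_sub ei.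
  exact: (smooth_fieldZ oU (smooth_on_rsqrt oU hU (smooth_on_sub UU1 hU1))
    (smooth_field_sub UU1 WU1)).
- move=> q Uq i j; have U1q := UU1 q Uq; have [U0q _] := U1q.
  rewrite !ltnS => ik jk.
  have [ik'|ki] := ltnP i k; have [jk'|kj] := ltnP j k.
  + exact: e_orth.
  + rewrite metricZr metricC We// mulr0.
    by rewrite (_ : i == j = false)//; apply/ltn_eqF/(leq_trans ik').
  + rewrite metricZl We// mulr0.
    by rewrite (_ : i == j = false)//; apply/gtn_eqF/(leq_trans jk').
  + have -> : i = j by apply/eqP; rewrite eqn_leq (leq_trans ik) ?(leq_trans jk).
    rewrite eqxx metricZl metricZr mulrA -invfM -expr2 sqr_sqrtr; last exact/ltW/hU.
    by rewrite mulVf// gt_eqF//; exact: hU.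
Qed.

Lemma frame_atP p : exists U, [/\ open U, U p & orthonormal_frame g U (frame_at g p)].
Proof.
have [U [e [oU Up eU ee]]] := exists_partial_frame p (leqnn m).
rewrite /frame_at; apply: (@xgetPex _ _ [set e : 'I_m -> vfield M |
  exists U : set M, [/\ open U, U p & orthonormal_frame g U e]]).
exists (fun i => e i), U; split=> //; split=> [i|q Uq i j]; first exact: eU.
exact: ee.
Qed.

Lemma dirder_vec_sum U f p (I : Type) (r : seq I) (a : I -> R) (F : I -> 'rV[R]_m) :
  open U -> U p -> smooth_on U f ->
  dirder (fun _ => \sum_(i <- r) a i *: F i) f p
    = \sum_(i <- r) a i * dirder (fun _ => F i) f p.
Proof.
move=> oU Up fU; elim: r => [|i r IH].
  by rewrite !big_nil; exact: derive0.
by rewrite !big_cons -IH -(dirder_linear oU Up fU).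
Qed.

(** The gradient is a chosen solution of its defining equation; an orthonormal
    frame e at p provides a solution, the sum of the e_i(f) e_i. *)
Lemma gradP U f p X : open U -> U p -> smooth_on U f ->
  g p (grad g f p) (X p) = dirder X f p.
Proof.
move=> oU Up fU.
suff H v : g p (grad g f p) v = dirder (fun _ => v) f p by exact: H.
move: v; apply: (@xgetPex _ _ [set u : 'rV[R]_m |
  forall v, g p u v = dirder (fun _ => v) f p]).
have [V [oV Vp [eV ee]]] := frame_atP p; set e := frame_at g p in eV ee *.
have ex := orthonormal_expansion (ee p Vp).
exists (\sum_i dirder (e i) f p *: e i p) => v.
rewrite [in RHS](ex v) (dirder_vec_sum _ _ _ oU Up fU) metric_suml.
by apply: eq_bigr => i _; rewrite metricZl mulrC metricC.
Qed.

(** Near p the gradient of f is the sum of the e_i(f) e_i for a smooth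
    orthonormal frame e. *)
Lemma smooth_grad U f : open U -> smooth_on U f -> smooth_field U (grad g f).
Proof.
move=> oU fU; apply: smooth_field_local => p Up.
have [V [oV Vp [eV ee]]] := frame_atP p; set e := frame_at g p in eV ee *.
exists (U `&` V); split=> //; have oW : open (U `&` V) by exact: openI.
have eW i : smooth_field (U `&` V) (e i) by apply: smooth_field_sub (eV i) => q [].
have fW : smooth_on (U `&` V) f by apply: smooth_on_sub fU => q [].
have : smooth_field (U `&` V) (fun q => \sum_i dirder (e i) f q *: e i q).
  apply: smooth_field_sum => // i; apply: smooth_fieldZ => //.
  exact: smooth_dirder.
apply: smooth_field_eq => // q [Uq Vq].
rewrite [RHS](orthonormal_expansion (ee q Vq)); apply: eq_bigr => i _.
by rewrite (gradP _ oU Uq fU).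
Qed.

End Metric.

(** * The Levi-Civita connection *)

Section LeviCivita.
Context {R : realType} {m : nat} {M : manifold R m} {g : riemannian_metric M}.
Context {nabla : vfield M -> vfield M -> vfield M} (lc : levi_civita g nabla).
Context {U : set M} (oU : open U).
Implicit Types (f : M -> R) (X Y Z : vfield M) (p : M).
Local Notation smooth := (smooth_field U).

(** A connection is a local operator.  The difference Z of the two fields
    vanishes on U, so Z = s Z for the function s equal to 0 on U and to 1
    elsewhere; s is smooth on U, and the Leibniz rule for s Z gives 0 on U. *)
Lemma nabla_eq_r X Y Y' p : smooth X -> smooth Y -> smooth Y' ->
  (forall q, U q -> Y q = Y' q) -> U p -> nabla X Y p = nabla X Y' p.
Proof.
move=> XU YU YU' YY' Up; pose Z q := Y' q - Y q.
have Z0 q : U q -> Z q = 0 by move=> Uq; rewrite /Z YY'// subrr.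
have ZU : smooth Z by exact: smooth_fieldB.
pose s : M -> R := fun q => if `[< U q >] then 0 else 1.
have s0 q : U q -> 0 = s q by move=> Uq; rewrite /s asboolT.
have sU : smooth_on U s by apply: smooth_on_eq (smooth_on_cst U 0).
have ZE : Z = (fun q => s q *: Z q).
  apply/funext => q; rewrite /s; case: asboolP => [/Z0 ->|_].
    by rewrite scaler0.
  by rewrite scale1r.
have nZ : nabla X Z p = 0.
  rewrite ZE (lc_leibniz lc oU sU XU ZU Up) Z0// scaler0 add0r -s0//.
  by rewrite scale0r.
have -> : Y' = (fun q => Y q + Z q) by apply/funext => q; rewrite /Z addrC subrK.
by rewrite (lc_additive lc oU XU YU ZU Up) nZ addr0.
Qed.

Lemma nablaNr X Y p : smooth X -> smooth Y -> U p ->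
  nabla X (fun q => - Y q) p = - nabla X Y p.
Proof.
move=> XU YU Up.
have -> : (fun q => - Y q) = (fun q => -1 *: Y q).
  by apply/funext => q; rewrite scaleN1r.
rewrite (lc_leibniz lc oU (smooth_on_cst U (-1)) XU YU Up) dirder_cst.
by rewrite scale0r add0r scaleN1r.
Qed.

Lemma nablaBr X Y Z p : smooth X -> smooth Y -> smooth Z -> U p ->
  nabla X (fun q => Y q - Z q) p = nabla X Y p - nabla X Z p.
Proof.
move=> XU YU ZU Up.
by rewrite (lc_additive lc oU XU YU (smooth_fieldN oU ZU) Up) nablaNr.
Qed.

Lemma smooth_nabla X Y : smooth X -> smooth Y -> smooth (nabla X Y).
Proof. exact: (lc_smooth lc oU). Qed.

Lemma nabla_torsion X Y p : smooth X -> smooth Y -> U p ->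
  bracket X Y p = nabla X Y p - nabla Y X p.
Proof. by move=> XU YU Up; rewrite (lc_torsion_free lc oU XU YU Up). Qed.

Lemma nabla_metric X Y Z p : smooth X -> smooth Y -> smooth Z -> U p ->
  dirder X (fun q => g q (Y q) (Z q)) p
    = g p (nabla X Y p) (Z p) + g p (Y p) (nabla X Z p).
Proof. by move=> XU YU ZU Up; exact: (lc_metric lc oU). Qed.

(** This follows from the derivative along X of g(grad f, Y) = Y(f). *)
Lemma hessianE f X Y p : smooth_on U f -> smooth X -> smooth Y -> U p ->
  hessian g nabla f X Y p = dirder X (dirder Y f) p - dirder (nabla X Y) f p.
Proof.
move=> fU XU YU Up; have GU := smooth_grad g oU fU.
have := nabla_metric XU GU YU Up.
rewrite (gradP g _ oU Up fU) (_ : dirder X _ p = dirder X (dirder Y f) p).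
  by move=> ->; rewrite /hessian addrK.
by apply: (dirder_near _ oU Up) => q Uq; rewrite (gradP g _ oU Uq fU).
Qed.

(** The additivity of the bracket is inherited from that of the connection, by
    the absence of torsion. *)
Lemma bracketBr X Y Z p : smooth X -> smooth Y -> smooth Z -> U p ->
  bracket X (fun q => Y q - Z q) p = bracket X Y p - bracket X Z p.
Proof.
move=> XU YU ZU Up; rewrite (nabla_torsion XU (smooth_fieldB oU YU ZU) Up).
rewrite (nabla_torsion XU YU Up) (nabla_torsion XU ZU Up).
rewrite nablaBr//.
have -> : (fun q => Y q - Z q) = (fun q => -1 *: Z q + Y q).
  by apply/funext => q; rewrite scaleN1r addrC.
rewrite (lc_linear lc oU (smooth_on_cst U (-1)) ZU YU XU Up).
by apply/rowP => i; rewrite !mxE; ring.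
Qed.

Lemma bracket_eq_r X Y Y' p : smooth X -> smooth Y -> smooth Y' ->
  (forall q, U q -> Y q = Y' q) -> U p -> bracket X Y p = bracket X Y' p.
Proof.
move=> XU YU YU' YY' Up; apply/rowP => i; pose x q := cmap (chart_at p) q 0 i.
have dY q h : U q -> dirder Y h q = dirder Y' h q.
  by move=> /YY'; exact: dirder_vec.
have e1 : dirder X (dirder Y x) p = dirder X (dirder Y' x) p.
  by apply: (dirder_near X oU Up) => q /dY.
rewrite [LHS]mxE [RHS]mxE; exact: (congr2 (fun a b => a - b) e1 (dY p (dirder X x) Up)).
Qed.

End LeviCivita.

(** Alternating the two symmetries three times brings the arguments back to
    their initial order with the sign reversed.  This is the argument for the
    uniqueness of the Levi-Civita connection; P singles out the smooth fields. *)
Lemma symmetric_skew_eq0 (R : realFieldType) (T : Type) (P : T -> Prop)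
    (b : T -> T -> T -> R) :
  (forall x y z, P x -> P y -> P z -> b x y z = b y x z) ->
  (forall x y z, P x -> P y -> P z -> b x y z = - b x z y) ->
  forall x y z, P x -> P y -> P z -> b x y z = 0.
Proof.
move=> sym skew x y z Px Py Pz.
have : b x y z = - b x y z.
  rewrite {1}skew// sym// skew// sym// skew// sym//.
  by rewrite opprK.
lra.
Qed.

(** * Contact metric structures and the Lie derivative along xi *)

Section AlmostContact.
Context {R : realType} {m : nat} {M : manifold R m} {g : riemannian_metric M}.
Context {phi : M -> 'rV[R]_m -> 'rV[R]_m} {xi : vfield M} {eta : M -> 'rV[R]_m -> R}.
Context (acm : almost_contact_metric g phi xi eta).
Implicit Types (p : M) (u v : 'rV[R]_m).

Lemma phiD p u v : phi p (u + v) = phi p u + phi p v.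
Proof. by have := acm_phi_linear acm p 1 u v; rewrite !scale1r. Qed.

Lemma phi0 p : phi p 0 = 0.
Proof. by apply: (addrI (phi p 0)); rewrite -phiD !addr0. Qed.

Lemma phiZ p a u : phi p (a *: u) = a *: phi p u.
Proof. by have := acm_phi_linear acm p a u 0; rewrite phi0 !addr0. Qed.

Lemma phiN p u : phi p (- u) = - phi p u.
Proof. by rewrite -scaleN1r phiZ scaleN1r. Qed.

Lemma phiB p u v : phi p (u - v) = phi p u - phi p v.
Proof. by rewrite phiD phiN. Qed.

Lemma etaD p u v : eta p (u + v) = eta p u + eta p v.
Proof. by have := acm_eta_linear acm p 1 u v; rewrite scale1r mul1r. Qed.

Lemma eta0 p : eta p 0 = 0.
Proof. by apply: (addrI (eta p 0)); rewrite -etaD !addr0. Qed.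

Lemma etaZ p a u : eta p (a *: u) = a * eta p u.
Proof. by have := acm_eta_linear acm p a u 0; rewrite eta0 !addr0. Qed.

Lemma etaN p u : eta p (- u) = - eta p u.
Proof. by rewrite -scaleN1r etaZ mulN1r. Qed.

Lemma etaB p u v : eta p (u - v) = eta p u - eta p v.
Proof. by rewrite etaD etaN. Qed.

(** From phi^2 xi = 0 and the formula for phi^2 applied to phi xi one gets
    phi xi = k xi with k = eta(phi xi); then k^2 = 0. *)
Lemma phi_xi p : phi p (xi p) = 0.
Proof.
have pp : phi p (phi p (xi p)) = 0.
  by rewrite (acm_phi2 acm) (acm_eta_xi acm) scale1r addNr.
have := acm_phi2 acm p (phi p (xi p)); rewrite pp phi0 => /esym/eqP.
rewrite addrC subr_eq0 => /eqP pE.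
have e0 : eta p (phi p (xi p)) = 0.
  move: pp pE; set k := eta p _ => pp pE; move: pp.
  rewrite -pE phiZ -pE scalerA => /(congr1 (eta p)).
  by rewrite etaZ (acm_eta_xi acm) mulr1 eta0 => /eqP; rewrite mulf_eq0 orbb => /eqP.
by rewrite -pE e0 scale0r.
Qed.

(** The two ways of computing phi^3 u differ by eta(phi u) xi. *)
Lemma eta_phi p u : eta p (phi p u) = 0.
Proof.
have := acm_phi2 acm p (phi p u); rewrite (acm_phi2 acm p u) phiD phiN phiZ phi_xi.
rewrite scaler0 addr0 => /eqP; rewrite eq_sym addrC -subr_eq0 opprK addrNK => /eqP.
by move=> /(congr1 (eta p)); rewrite etaZ (acm_eta_xi acm) mulr1 eta0.
Qed.

Lemma metric_xi p u : g p u (xi p) = eta p u.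
Proof.
have := acm_compatible acm p u (xi p).
by rewrite phi_xi metric0r (acm_eta_xi acm) mulr1 => /esym/eqP; rewrite subr_eq0 => /eqP.
Qed.

(** Compatibility of g with phi, applied to phi u and v, together with the
    formula for phi^2. *)
Lemma metric_phi_skew p u v : g p (phi p u) v = - g p u (phi p v).
Proof.
have := acm_compatible acm p (phi p u) v.
rewrite eta_phi mul0r subr0 => <-.
rewrite (acm_phi2 acm) metricDl metricNl metricZl (metricC g p (xi p)).
by rewrite metric_xi eta_phi mulr0 addr0.
Qed.

Lemma phi_eq0 p u : phi p u = 0 -> u = eta p u *: xi p.
Proof.
move=> pu; have := acm_phi2 acm p u; rewrite pu phi0 => /esym/eqP.
by rewrite addrC subr_eq0 => /eqP.
Qed.

End AlmostContact.

(** The following three definitions apply a tensor pointwise to fields.  As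
    named functions of the fields they keep the expressions recognisable
    under derivations and brackets. *)
Definition phi_field {R : realType} {m : nat} {M : manifold R m}
  (phi : M -> 'rV[R]_m -> 'rV[R]_m) (X : vfield M) : vfield M := fun p => phi p (X p).

Definition eta_field {R : realType} {m : nat} {M : manifold R m}
  (eta : M -> 'rV[R]_m -> R) (X : vfield M) : M -> R := fun p => eta p (X p).

Definition metric_field {R : realType} {m : nat} {M : manifold R m}
  (g : riemannian_metric M) (X Y : vfield M) : M -> R := fun p => g p (X p) (Y p).

Lemma lie_contact_sum (R : realFieldType)
    (w w1 w2 xXY xYX xB a1 b1 c1 a2 b2 c2 j : R) :
  2 * w = xXY - xYX - xB -> a1 - b1 - c1 = 2 * w1 -> a2 - b2 - c2 = 2 * w2 ->
  j = c1 + c2 -> a1 = xXY - a2 -> b2 = xYX - b1 -> xB = j -> w = w1 + w2.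
Proof. by move=> h1 h2 h3 h4 h5 h6 h7; lra. Qed.

Lemma lie_metric_sum (R : comRingType) (w w1 w2 x x' y y' s t u v : R) :
  w = w1 + w2 -> x' = u -> y' = v -> s = w1 + u * y -> t = w2 + x * v ->
  w + (x' * y + x * y') = s + t.
Proof. by move=> -> -> -> -> ->; ring. Qed.

Section ContactLie.
Context {R : realType} {m : nat} {M : manifold R m} {g : riemannian_metric M}.
Context {phi : M -> 'rV[R]_m -> 'rV[R]_m} {xi : vfield M} {eta : M -> 'rV[R]_m -> R}.
Context (sas : sasakian g phi xi eta).
Context {U : set M} (oU : open U).
Implicit Types (X Y Z : vfield M) (p : M).
Local Notation smooth := (smooth_field U).
Local Notation J := (phi_field phi).
Local Notation E := (eta_field eta).
Local Notation G := (metric_field g).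
Let acm : almost_contact_metric g phi xi eta := sas.1.1.

Lemma smooth_phi_field X : smooth X -> smooth (J X).
Proof. exact: (acm_phi_smooth acm oU). Qed.

Lemma smooth_eta_field X : smooth X -> smooth_on U (E X).
Proof. exact: (acm_eta_smooth acm oU). Qed.

Lemma smooth_metric_field X Y : smooth X -> smooth Y -> smooth_on U (G X Y).
Proof. exact: smooth_metric. Qed.

Lemma smooth_xi : smooth xi.
Proof. by apply: smooth_field_sub (acm_xi_smooth acm). Qed.

Local Hint Resolve smooth_phi_field smooth_eta_field smooth_metric_field smooth_xi : core.
Let sbr X Y := @smooth_bracket R m M U X Y oU.
Let sdir X f := @smooth_dirder R m M U X f oU.
Local Hint Resolve sbr sdir : core.

Lemma contactE X Y p : smooth X -> smooth Y -> U p ->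
  dirder X (E Y) p - dirder Y (E X) p - E (bracket X Y) p = 2 * G X (J Y) p.
Proof.
move=> XU YU Up.
have -> : G X (J Y) p = dform eta X Y p by exact: esym (sas.1.2 U X Y oU XU YU p Up).
by rewrite /dform mulrA mulfV ?mul1r.
Qed.

Lemma dirder_eta_xi X p : U p -> dirder X (E xi) p = 0.
Proof.
move=> Up; rewrite -[RHS](dirder_cst p X 1); apply: (dirder_near _ oU Up) => q _.
exact: (acm_eta_xi acm).
Qed.

(** The contact condition at (xi, Y): the terms eta(xi) = 1 and
    g(xi, phi Y) = 0 drop out. *)
Lemma lie_eta Y p : smooth Y -> U p ->
  dirder xi (E Y) p = eta p (bracket xi Y p).
Proof.
move=> YU Up; have := contactE smooth_xi YU Up.
rewrite dirder_eta_xi// /metric_field metricC (metric_xi acm) (eta_phi acm) mulr0 subr0.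
by move=> /eqP; rewrite subr_eq0 => /eqP.
Qed.

(** Normality at (xi, Y) says phi (phi [xi, Y] - [xi, phi Y]) = 0, so the
    difference is a multiple of xi.  Its component along xi vanishes by lie_eta,
    because eta(phi Y) = 0 identically. *)
Lemma lie_phi Y p : smooth Y -> U p ->
  bracket xi (J Y) p = phi p (bracket xi Y p).
Proof.
move=> YU Up; have JY : smooth (J Y) by exact: smooth_phi_field.
have := sas.2 U xi Y oU smooth_xi YU p Up; rewrite /nijenhuis.
rewrite -/(J xi) -/(J Y).
have -> : dform eta xi Y p = 0.
  rewrite (sas.1.2 U xi Y oU smooth_xi YU p Up) metricC (metric_xi acm).
  exact: (eta_phi acm).
have b0 Z : smooth Z -> bracket (J xi) Z p = 0.
  move=> ZU; apply: (vfield_eq (Y := fun _ => 0) oU Up) => V f oV Vp VU fV.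
  have Jxi0 h q : dirder (J xi) h q = 0.
    rewrite {1}/dirder /phi_field (phi_xi acm); exact: derive0.
  rewrite (bracketE oV Vp (smooth_field_sub VU (smooth_phi_field smooth_xi))
    (smooth_field_sub VU ZU) fV) Jxi0 sub0r.
  rewrite (dirder_near _ oV Vp (fun q _ => Jxi0 f q)) dirder_cst oppr0.
  by apply/esym; exact: derive0.
rewrite mulr0 oppr0 scale0r (b0 _ JY) (b0 _ YU) (phi0 acm) subr0 addr0 -(phiB acm).
move=> /(phi_eq0 acm); rewrite (etaB acm) (eta_phi acm) sub0r -(lie_eta JY Up).
rewrite (_ : dirder xi (E (J Y)) p = 0) ?oppr0 ?scale0r.
  by move=> /eqP; rewrite subr_eq0 => /eqP.
rewrite -[RHS](dirder_cst p xi 0); apply: (dirder_near _ oU Up) => q _.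
exact: (eta_phi acm).
Qed.

Lemma lie_dirder X f p : smooth X -> smooth_on U f -> U p ->
  dirder (bracket xi X) f p = dirder xi (dirder X f) p - dirder X (dirder xi f) p.
Proof. by move=> XU fU Up; exact: bracketE smooth_xi XU fU. Qed.

Lemma dirder_lie_eta X Y p : smooth X -> smooth Y -> U p ->
  dirder X (dirder xi (E Y)) p = dirder X (E (bracket xi Y)) p.
Proof.
by move=> XU YU Up; apply: (dirder_near _ oU Up) => q Uq; exact: lie_eta.
Qed.

(** The 2-form g(X, phi Y) = d eta (X, Y) is invariant under xi, because eta is
    and because the Lie derivative commutes with d; the commutation is carried
    out here on the formula for d, by means of the Jacobi identity. *)
Lemma lie_contact X Y p : smooth X -> smooth Y -> U p ->
  dirder xi (G X (J Y)) p = G (bracket xi X) (J Y) p + G X (J (bracket xi Y)) p.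
Proof.
move=> XU YU Up; have [[bX bY] bXY] := (sbr smooth_xi XU, sbr smooth_xi YU, sbr XU YU).
have lhs : 2 * dirder xi (G X (J Y)) p = dirder xi (dirder X (E Y)) p
    - dirder xi (dirder Y (E X)) p - dirder xi (E (bracket X Y)) p.
  have d1 := sdir XU (smooth_eta_field YU); have d2 := sdir YU (smooth_eta_field XU).
  have d3 := smooth_eta_field bXY.
  rewrite -(dirderB _ oU Up d1 d2) -(dirderB _ oU Up (smooth_onB oU d1 d2) d3).
  have gs := smooth_metric_field XU (smooth_phi_field YU).
  have := dirderM xi oU Up (smooth_on_cst U 2) gs; rewrite dirder_cst mul0r add0r => <-.
  by apply: (dirder_near _ oU Up) => q Uq; exact/esym/contactE.
have e1 := contactE bX YU Up.
have e2 := contactE XU bY Up.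
have ej : E (bracket xi (bracket X Y)) p = E (bracket (bracket xi X) Y) p
    + E (bracket X (bracket xi Y)) p.
  by rewrite /eta_field (jacobi oU Up smooth_xi XU YU) (etaD acm).
have l1 := lie_dirder XU (smooth_eta_field YU) Up.
have l2 := lie_dirder YU (smooth_eta_field XU) Up.
have l3 := lie_eta bXY Up; rewrite -/(eta_field eta (bracket xi (bracket X Y)) p) in l3.
rewrite (dirder_lie_eta XU YU Up) in l1; rewrite (dirder_lie_eta YU XU Up) in l2.
exact: lie_contact_sum lhs e1 e2 ej l1 l2 l3.
Qed.

Lemma metric_split X Y p : G X Y p = G (J X) (J Y) p + E X p * E Y p.
Proof. by rewrite /metric_field (acm_compatible acm) subrK. Qed.

(** The field xi is Killing: g(X, Y) = d eta (phi X, Y) + eta(X) eta(Y), and each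
    ingredient is invariant under xi. *)
Lemma lie_metric X Y p : smooth X -> smooth Y -> U p ->
  dirder xi (G X Y) p = G (bracket xi X) Y p + G X (bracket xi Y) p.
Proof.
move=> XU YU Up.
have [[EX EY] JX] := (smooth_eta_field XU, smooth_eta_field YU, smooth_phi_field XU).
have GJ := smooth_metric_field JX (smooth_phi_field YU).
have -> : dirder xi (G X Y) p
    = dirder xi (fun q => G (J X) (J Y) q + E X q * E Y q) p.
  by apply: (dirder_near _ oU Up) => q _; exact: metric_split.
rewrite (dirderD _ oU Up GJ (smooth_onM oU EX EY)) (dirderM _ oU Up EX EY).
have e1 : dirder xi (G (J X) (J Y)) p
    = G (J (bracket xi X)) (J Y) p + G (J X) (J (bracket xi Y)) p.
  apply: etrans (lie_contact JX YU Up) (congr1 (fun a => a + _) _).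
  exact: (congr1 (fun v => g p v (J Y p)) (lie_phi XU Up)).
exact: lie_metric_sum e1 (lie_eta XU Up) (lie_eta YU Up)
  (metric_split (bracket xi X) Y p) (metric_split X (bracket xi Y) p).
Qed.

End ContactLie.

(** * The covariant derivative of phi *)

Lemma contact_closed_sum (R : realFieldType) (w1 w2 w3 v1 v2 v3 : R)
    (XYz XZy Xyz YXz YZx Yxz ZXy ZYx Zxy h1 h2 h3 k2 k3 : R) :
  2 * w1 = XYz - XZy - Xyz -> 2 * w2 = YXz - YZx - Yxz -> 2 * w3 = ZXy - ZYx - Zxy ->
  2 * v1 = XYz - YXz - Zxy - h1 -> 2 * v2 = YZx - ZYx - Xyz - h2 ->
  2 * v3 = XZy - ZXy - Yxz - h3 -> h2 = - k2 -> h3 = - k3 -> k2 = h1 + k3 ->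
  w1 - w2 + w3 = v1 + v2 - v3.
Proof. by move=> *; lra. Qed.

Lemma nabla_phi_cyclic_sum (R : realFieldType) (w1 w2 w3 v1 v2 v3 : R)
    (a b c d f h n1 n2 n3 k1 k3 : R) :
  w1 - w2 + w3 = v1 + v2 - v3 ->
  w1 = a + n1 - b -> w2 = c + n2 - d -> w3 = f + n3 - h ->
  v1 = a - c -> v2 = d - h -> v3 = b - f -> k1 = - n1 -> k3 = - n3 ->
  k1 + n2 + k3 = 0.
Proof. by move=> *; lra. Qed.

(** This is the vector field (nabla_X phi) Y. *)
Definition nabla_phi {R : realType} {m : nat} {M : manifold R m}
    (nabla : vfield M -> vfield M -> vfield M) (phi : M -> 'rV[R]_m -> 'rV[R]_m)
    (X Y : vfield M) : vfield M :=
  fun p => nabla X (phi_field phi Y) p - phi p (nabla X Y p).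

Section SasakianConnection.
Context {R : realType} {m : nat} {M : manifold R m} {g : riemannian_metric M}.
Context {nabla : vfield M -> vfield M -> vfield M} (lc : levi_civita g nabla).
Context {phi : M -> 'rV[R]_m -> 'rV[R]_m} {xi : vfield M} {eta : M -> 'rV[R]_m -> R}.
Context (sas : sasakian g phi xi eta).
Implicit Types (U V : set M) (X Y Z W : vfield M) (p : M).
Local Notation J := (phi_field phi).
Local Notation E := (eta_field eta).
Local Notation G := (metric_field g).
Local Notation N := (nabla_phi nabla phi).
Let acm : almost_contact_metric g phi xi eta := sas.1.1.

Section OnOpenSet.
Context {U : set M} (oU : open U).
Local Notation smooth := (smooth_field U).

Let sxi : smooth xi. Proof. exact: (smooth_xi sas). Qed.
Let sJ X : smooth X -> smooth (J X). Proof. exact: (smooth_phi_field sas oU). Qed.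
Let sE X : smooth X -> smooth_on U (E X).
Proof. exact: (smooth_eta_field sas oU). Qed.
Let sG X Y : smooth X -> smooth Y -> smooth_on U (G X Y).
Proof. exact: (smooth_metric_field oU). Qed.
Let sB X Y : smooth X -> smooth Y -> smooth (bracket X Y).
Proof. exact: (smooth_bracket oU). Qed.
Let sD X f : smooth X -> smooth_on U f -> smooth_on U (dirder X f).
Proof. exact: (smooth_dirder oU). Qed.

Lemma dirder_metric X Y Z p : smooth X -> smooth Y -> smooth Z -> U p ->
  dirder X (G Y Z) p = G (nabla X Y) Z p + G Y (nabla X Z) p.
Proof. exact: (nabla_metric lc oU). Qed.

(** The Lie derivative of g along xi, written with the connection. *)
Lemma killing X Y p : smooth X -> smooth Y -> U p ->
  G (nabla X xi) Y p + G (nabla Y xi) X p = 0.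
Proof.
move=> XU YU Up; have e1 := lie_metric sas oU XU YU Up.
have e2 := dirder_metric sxi XU YU Up.
have e3 : G (bracket xi X) Y p = G (nabla xi X) Y p - G (nabla X xi) Y p.
  by rewrite /metric_field (nabla_torsion lc oU sxi XU Up) metricBl.
have e4 : G X (bracket xi Y) p = G X (nabla xi Y) p - G (nabla Y xi) X p.
  rewrite /metric_field (nabla_torsion lc oU sxi YU Up) metricBr.
  by rewrite (metricC g p (nabla Y xi p)).
lra.
Qed.

(** By the contact condition, d eta is the skew part of the covariant derivative
    of xi; by killing, the symmetric part is zero. *)
Lemma metric_nabla_xi X Y p : smooth X -> smooth Y -> U p ->
  G (nabla X xi) Y p = - G (J X) Y p.
Proof.
move=> XU YU Up; have e1 := contactE sas oU XU YU Up.
have EE Z W : smooth Z -> smooth W -> 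
    dirder Z (E W) p = G (nabla Z xi) W p + G xi (nabla Z W) p.
  move=> ZU WU; rewrite -(dirder_metric ZU sxi WU Up).
  by apply: (dirder_near _ oU Up) => q _; rewrite /eta_field -(metric_xi acm) metricC.
have e2 := EE X Y XU YU; have e3 := EE Y X YU XU.
have e4 : E (bracket X Y) p = G xi (nabla X Y) p - G xi (nabla Y X) p.
  rewrite /eta_field (nabla_torsion lc oU XU YU Up) -(metric_xi acm) metricC.
  by rewrite metricBr.
have e5 := killing XU YU Up.
have e6 : G (J X) Y p = - G X (J Y) p by exact: (metric_phi_skew acm).
lra.
Qed.

Lemma nabla_phi_metric X Y Z p :
  G (N X Y) Z p = G (nabla X (J Y)) Z p + G (nabla X Y) (J Z) p.
Proof.
by rewrite /metric_field metricBl (metric_phi_skew acm) opprK.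
Qed.

(** The derivative of the identity g(phi Y, Z) = - g(Y, phi Z) along X. *)
Lemma nabla_phi_skew X Y Z p : smooth X -> smooth Y -> smooth Z -> U p ->
  G (N X Y) Z p = - G (N X Z) Y p.
Proof.
move=> XU YU ZU Up; have e1 := dirder_metric XU (sJ YU) ZU Up.
have e2 := dirder_metric XU YU (sJ ZU) Up.
have e3 : dirder X (G (J Y) Z) p = - dirder X (G Y (J Z)) p.
  rewrite -(dirderN X oU Up (sG YU (sJ ZU))).
  by apply: (dirder_near _ oU Up) => q _; exact: (metric_phi_skew acm).
have e4 := nabla_phi_metric X Y Z p; have e5 := nabla_phi_metric X Z Y p.
have e6 : G Y (nabla X (J Z)) p = G (nabla X (J Z)) Y p by exact: metricC.
have e7 : G (J Y) (nabla X Z) p = G (nabla X Z) (J Y) p by exact: metricC.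
lra.
Qed.

(** The identity d(d eta) = 0 for the 2-form g(X, phi Y) = d eta (X, Y). *)
Lemma contact_closed X Y Z p : smooth X -> smooth Y -> smooth Z -> U p ->
  dirder X (G Y (J Z)) p - dirder Y (G X (J Z)) p + dirder Z (G X (J Y)) p
  = G (bracket X Y) (J Z) p + G (bracket Y Z) (J X) p - G (bracket X Z) (J Y) p.
Proof.
move=> XU YU ZU Up.
have dG A B C : smooth A -> smooth B -> smooth C ->
    2 * dirder A (G B (J C)) p = dirder A (dirder B (E C)) p
      - dirder A (dirder C (E B)) p - dirder A (E (bracket B C)) p.
  move=> AU BU CU; have d1 := sD BU (sE CU); have d2 := sD CU (sE BU).
  have d3 := sE (sB BU CU).
  rewrite -(dirderB _ oU Up d1 d2) -(dirderB _ oU Up (smooth_onB oU d1 d2) d3).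
  have := dirderM A oU Up (smooth_on_cst U 2) (sG BU (sJ CU)).
  rewrite dirder_cst mul0r add0r => <-.
  by apply: (dirder_near _ oU Up) => q Uq; exact/esym/(contactE sas oU).
have bG A B C : smooth A -> smooth B -> smooth C ->
    2 * G (bracket A B) (J C) p = dirder A (dirder B (E C)) p
      - dirder B (dirder A (E C)) p - dirder C (E (bracket A B)) p
      - E (bracket (bracket A B) C) p.
  move=> AU BU CU; rewrite -(contactE sas oU (sB AU BU) CU Up).
  by rewrite (bracketE oU Up AU BU (sE CU)).
have e1 := dG X Y Z XU YU ZU; have e2 := dG Y X Z YU XU ZU.
have e3 := dG Z X Y ZU XU YU; have e4 := bG X Y Z XU YU ZU.
have e5 := bG Y Z X YU ZU XU; have e6 := bG X Z Y XU ZU YU.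
have j1 : E (bracket (bracket Y Z) X) p = - E (bracket X (bracket Y Z)) p.
  exact: etrans (congr1 (eta p) (bracket_anti _ _ p)) (etaN acm _ _).
have j2 : E (bracket (bracket X Z) Y) p = - E (bracket Y (bracket X Z)) p.
  exact: etrans (congr1 (eta p) (bracket_anti _ _ p)) (etaN acm _ _).
have j3 : E (bracket X (bracket Y Z)) p
    = E (bracket (bracket X Y) Z) p + E (bracket Y (bracket X Z)) p.
  exact: etrans (congr1 (eta p) (jacobi oU Up XU YU ZU)) (etaD acm _ _ _).
exact: contact_closed_sum e1 e2 e3 e4 e5 e6 j1 j2 j3.
Qed.

(** In d(d eta) = 0 the derivatives of the fields cancel against the brackets,
    the connection being torsion-free, and only the derivatives of phi remain. *)
Lemma nabla_phi_cyclic X Y Z p : smooth X -> smooth Y -> smooth Z -> U p ->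
  G (N X Y) Z p + G (N Y Z) X p + G (N Z X) Y p = 0.
Proof.
move=> XU YU ZU Up; have e := contact_closed XU YU ZU Up.
have dG A B C : smooth A -> smooth B -> smooth C -> dirder A (G B (J C)) p
    = G (nabla A B) (J C) p + G (N A C) B p - G (nabla A C) (J B) p.
  move=> AU BU CU; rewrite (dirder_metric AU BU (sJ CU) Up) nabla_phi_metric.
  have -> : G B (nabla A (J C)) p = G (nabla A (J C)) B p by exact: metricC.
  by rewrite addrA addrK.
have bG A B C : smooth A -> smooth B -> G (bracket A B) (J C) p
    = G (nabla A B) (J C) p - G (nabla B A) (J C) p.
  by move=> AU BU; rewrite /metric_field (nabla_torsion lc oU AU BU Up) metricBl.
have e1 := dG X Y Z XU YU ZU; have e2 := dG Y X Z YU XU ZU.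
have e3 := dG Z X Y ZU XU YU; have e4 := bG X Y Z XU YU.
have e5 := bG Y Z X YU ZU; have e6 := bG X Z Y XU ZU.
have s1 := nabla_phi_skew XU YU ZU Up; have s2 := nabla_phi_skew ZU XU YU Up.
exact: nabla_phi_cyclic_sum e e1 e2 e3 e4 e5 e6 s1 s2.
Qed.

Lemma nabla0r X p : smooth X -> U p -> nabla X (fun _ => 0) p = 0.
Proof.
move=> XU Up; have := lc_leibniz lc oU (smooth_on_cst U 0) XU (smooth_field0 oU) Up.
have -> : (fun q : M => 0 *: (0 : 'rV[R]_m)) = (fun=> 0).
  by apply/funext => q; rewrite scaler0.
by move=> ->; rewrite scaler0 scale0r addr0.
Qed.

End OnOpenSet.

Lemma nabla_xi U X p : open U -> smooth_field U X -> U p ->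
  nabla X xi p = - phi p (X p).
Proof.
move=> oU XU Up; apply: (metric_eq_fields (g := g) oU Up) => V Z oV Vp VU ZV.
rewrite metricNl.
exact: (metric_nabla_xi oV (smooth_field_sub VU XU) ZV Vp).
Qed.

Section ReebCovariantDerivative.
Context {U : set M} (oU : open U).
Local Notation smooth := (smooth_field U).

Let sxi : smooth xi. Proof. exact: (smooth_xi sas). Qed.
Let sJ X : smooth X -> smooth (J X). Proof. exact: (smooth_phi_field sas oU). Qed.
Let sE X : smooth X -> smooth_on U (E X).
Proof. exact: (smooth_eta_field sas oU). Qed.

Lemma nabla_phi_xi X p : smooth X -> U p -> N X xi p = phi p (phi p (X p)).
Proof.
move=> XU Up; rewrite /nabla_phi (nabla_xi oU XU Up) (phiN acm) opprK.
have -> : J xi = fun=> 0 by apply/funext => q; exact: (phi_xi acm).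
by rewrite (nabla0r oU XU Up) add0r.
Qed.

(** The derivative along X of phi^2 = - id + eta (x) xi. *)
Lemma nabla_phi_phi X Y p : smooth X -> smooth Y -> U p ->
  N X (J Y) p + phi p (N X Y p)
  = - G Y (J X) p *: xi p - E Y p *: phi p (X p).
Proof.
move=> XU YU Up.
have JJY : J (J Y) = fun q => E Y q *: xi q - Y q.
  by apply/funext => q; rewrite /phi_field (acm_phi2 acm) addrC.
have dE : dirder X (E Y) p = eta p (nabla X Y p) - G Y (J X) p.
  have -> : dirder X (E Y) p = dirder X (G Y xi) p.
    by apply: (dirder_near _ oU Up) => q _; rewrite /metric_field (metric_xi acm).
  rewrite (dirder_metric oU XU YU sxi Up) {1 2}/metric_field (metric_xi acm).
  by rewrite (nabla_xi oU XU Up) metricNr.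
rewrite /nabla_phi JJY (nablaBr lc oU XU (smooth_fieldZ oU (sE YU) sxi) YU Up).
rewrite (lc_leibniz lc oU (sE YU) XU sxi Up) (nabla_xi oU XU Up) dE.
rewrite (phiB acm) (acm_phi2 acm p (nabla X Y p)).
move: (phi p (nabla X (J Y) p)) (nabla X Y p) (phi p (X p)) => a b c.
by apply/rowP => i; rewrite !mxE; ring.
Qed.

(** The normality condition, with all brackets expressed by the connection: the
    second derivatives of the fields cancel and only nabla phi remains. *)
Lemma nabla_phi_normal X Y p : smooth X -> smooth Y -> U p ->
  N (J X) Y p - N (J Y) X p - phi p (N X Y p) + phi p (N Y X p)
  = - (2 * G X (J Y) p) *: xi p.
Proof.
move=> XU YU Up; have := sas.2 U X Y oU XU YU p Up.
rewrite (sas.1.2 U X Y oU XU YU p Up) => <-.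
rewrite /nijenhuis -/(J X) -/(J Y) /nabla_phi.
rewrite (nabla_torsion lc oU XU YU Up) (nabla_torsion lc oU (sJ XU) (sJ YU) Up).
rewrite (nabla_torsion lc oU (sJ XU) YU Up) (nabla_torsion lc oU XU (sJ YU) Up).
rewrite !(phiB acm).
move: (nabla (J X) (J Y) p) (nabla (J Y) (J X) p) => a1 a2.
move: (phi p (nabla (J X) Y p)) (phi p (nabla (J Y) X p)) => b1 b2.
move: (phi p (nabla X (J Y) p)) (phi p (nabla Y (J X) p)) => c1 c2.
move: (phi p (phi p (nabla X Y p))) (phi p (phi p (nabla Y X p))) => d1 d2.
by apply/rowP => i; rewrite !mxE; ring.
Qed.

End ReebCovariantDerivative.

End SasakianConnection.

(** * Curvature of a Sasakian manifold in the direction of xi *)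

(** This is applied to the difference S between g((nabla_x phi) y, z) and its
    expected value.  The sum S(Jx, y, z) + S(x, Jy, z) is symmetric in x, y and
    skew in y, z, hence zero; then the cyclic identity at (Jx, y, z) and its
    cyclic permutations form a linear system with only the zero solution. *)
Lemma sasakian_algebra (R : realFieldType) (T : Type) (P : T -> Prop) (J : T -> T)
    (S : T -> T -> T -> R) :
  (forall x, P x -> P (J x)) ->
  (forall x y z, P x -> P y -> P z -> S x y z = - S x z y) ->
  (forall x y z, P x -> P y -> P z -> S x y z + S y z x + S z x y = 0) ->
  (forall x y z, P x -> P y -> P z -> S x (J y) z = S x y (J z)) ->
  (forall x y z, P x -> P y -> P z ->
    S (J x) y z - S (J y) x z + S x y (J z) - S y x (J z) = 0) ->
  forall x y z, P x -> P y -> P z -> S x (J y) z = 0.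
Proof.
move=> PJ skew cyc SJ norm.
have Q0 x y z : P x -> P y -> P z -> S (J x) y z + S x (J y) z = 0.
  move=> Px Py Pz; pose Q x y z := S (J x) y z + S x (J y) z.
  apply: (@symmetric_skew_eq0 R T P Q) => // {Px Py Pz x y z}x y z Px Py Pz; rewrite /Q.
    by have := norm x y z Px Py Pz; rewrite -!SJ//; lra.
  rewrite (skew (J x) y z) ?(SJ x y z)//; last exact: PJ.
  by rewrite (skew x y (J z)) ?opprD//; exact: PJ.
have C x y z : P x -> P y -> P z ->
    - S x (J y) z + S y (J z) x + S z (J x) y = 0.
  move=> Px Py Pz; have := cyc (J x) y z (PJ x Px) Py Pz.
  by have := Q0 x y z Px Py Pz; rewrite -(SJ y z x)//; lra.
move=> x y z Px Py Pz; have := C x y z Px Py Pz; have := C y z x Py Pz Px.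
by have := C z x y Pz Px Py; lra.
Qed.

Section SasakianFormulas.
Context {R : realType} {m : nat} {M : manifold R m} {g : riemannian_metric M}.
Context {nabla : vfield M -> vfield M -> vfield M} (lc : levi_civita g nabla).
Context {phi : M -> 'rV[R]_m -> 'rV[R]_m} {xi : vfield M} {eta : M -> 'rV[R]_m -> R}.
Context (sas : sasakian g phi xi eta).
Implicit Types (U V : set M) (X Y Z W : vfield M) (p : M).
Local Notation J := (phi_field phi).
Local Notation E := (eta_field eta).
Local Notation G := (metric_field g).
Local Notation N := (nabla_phi nabla phi).
Let acm : almost_contact_metric g phi xi eta := sas.1.1.

(** The four identities of sasakian_algebra hold for g((nabla_X phi) Y, Z), up to
    terms that the tensor g(X, Y) eta(Z) - eta(Y) g(X, Z) compensates. *)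
Lemma metric_nabla_phi_phi U X Y Z p : open U -> U p ->
  smooth_field U X -> smooth_field U Y -> smooth_field U Z ->
  G (N X (J Y)) Z p = G X (J Y) p * E Z p.
Proof.
move=> oU Up XU YU ZU.
pose S X Y Z := G (N X Y) Z p - (G X Y p * E Z p - E Y p * G X Z p).
have GC A B : G A B p = G B A p by exact: metricC.
have GJ A B : G (J A) B p = - G A (J B) p by exact: (metric_phi_skew acm).
have EJ A : E (J A) p = 0 by exact: (eta_phi acm).
have SJ0 : S X (J Y) Z = 0.
  apply: (@sasakian_algebra R (vfield M) (smooth_field U) J S _ _ _ _ _ X Y Z XU YU ZU).
  - by move=> A; exact: (smooth_phi_field sas oU).
  - move=> A B C AU BU CU; rewrite /S (nabla_phi_skew lc sas oU AU BU CU Up).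
    by ring.
  - move=> A B C AU BU CU; rewrite /S.
    have e := nabla_phi_cyclic lc sas oU AU BU CU Up.
    have -> : G (N A B) C p = - G (N B C) A p - G (N C A) B p by lra.
    by rewrite (GC B A) (GC C B) (GC C A); ring.
  - move=> A B C AU BU CU; rewrite /S !EJ.
    have e : G (N A (J B)) C p + G (J (N A B)) C p
        = - G B (J A) p * E C p - E B p * G (J A) C p.
      have := congr1 (fun v => g p v (C p)) (nabla_phi_phi lc sas oU AU BU Up).
      rewrite metricDl (metricBl g p (_ *: _)) !metricZl.
      by rewrite (metricC g p (xi p)) (metric_xi acm).
    rewrite (GJ (N A B)) (GJ A) in e; rewrite (GC A (J B)) GJ.
    by apply/eqP; rewrite -subr_eq0; apply/eqP; move: e; lra.
  - move=> A B C AU BU CU; rewrite /S !EJ.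
    have e : G (N (J A) B) C p - G (N (J B) A) C p - G (J (N A B)) C p
        + G (J (N B A)) C p = - (2 * G A (J B) p) * E C p.
      have := congr1 (fun v => g p v (C p)) (nabla_phi_normal lc sas oU AU BU Up).
      rewrite metricDl (metricBl g p (_ - _)) (metricBl g p (N _ _ _)) metricZl.
      by rewrite (metricC g p (xi p)) (metric_xi acm).
    rewrite !(GJ (N _ _)) in e; rewrite !(GJ A) !(GJ B) (GC B (J A)) !(GJ A).
    by move: e; lra.
by move/eqP: SJ0; rewrite /S EJ mul0r subr0 subr_eq0 => /eqP.
Qed.

Lemma nabla_phi_phiE U X Y p : open U -> U p -> smooth_field U X -> smooth_field U Y ->
  N X (J Y) p = G X (J Y) p *: xi p.
Proof.
move=> oU Up XU YU; apply: (metric_eq_fields (g := g) oU Up) => V Z oV Vp VU ZV.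
rewrite metricZl (metricC g p (xi p)) (metric_xi acm).
exact: (metric_nabla_phi_phi oV Vp (smooth_field_sub VU XU) (smooth_field_sub VU YU) ZV).
Qed.

(** The case of phi Y determines phi ((nabla_X phi) Y) by nabla_phi_phi; applying
    phi once more gives (nabla_X phi) Y up to its component along xi, which
    nabla_phi_skew and nabla_phi_xi provide. *)
Lemma nabla_phiE U X Y p : open U -> U p -> smooth_field U X -> smooth_field U Y ->
  N X Y p = G X Y p *: xi p - E Y p *: X p.
Proof.
move=> oU Up XU YU; have sxi : smooth_field U xi := smooth_xi sas.
have NY := nabla_phi_phiE oU Up XU YU.
have e1 : phi p (N X Y p) = - E Y p *: phi p (X p).
  have := nabla_phi_phi lc sas oU XU YU Up; rewrite NY.
  have -> : G X (J Y) p = - G Y (J X) p.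
    by rewrite /metric_field -(metric_phi_skew acm) metricC.
  by rewrite scaleNr => /addrI ->; rewrite scaleNr.
have e2 : eta p (N X Y p) = G X Y p - E X p * E Y p.
  rewrite -(metric_xi acm) -[g p _ _]/(G (N X Y) xi p).
  rewrite (nabla_phi_skew lc sas oU XU YU sxi Up) /metric_field.
  rewrite (nabla_phi_xi lc sas oU XU Up).
  rewrite (acm_phi2 acm) metricDl metricNl metricZl (metricC g p (xi p)) (metric_xi acm).
  by rewrite opprD opprK.
have := acm_phi2 acm p (N X Y p); rewrite e1 (phiZ acm) (acm_phi2 acm) e2.
rewrite /eta_field; move: (eta p (Y p)) (eta p (X p)) (G X Y p) (N X Y p) => a b c w h.
have -> : w = (c - b * a) *: xi p - - a *: (- X p + b *: xi p).
  by rewrite h opprD opprK addrCA subrr addr0.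
by apply/rowP => i; rewrite !mxE; ring.
Qed.

(** This is the Lie derivative of the connection along xi, which is a tensor. *)
Definition lie_nabla X Y : vfield M := fun p =>
  bracket xi (nabla X Y) p - nabla (bracket xi X) Y p - nabla X (bracket xi Y) p.

Lemma lie_nabla_sum (a b c d e1 e2 e3 e4 w t r : R) :
  w = a + b + (c + d) -> t = e1 + c + (b + e2) -> r = e3 + e4 -> r = w - t ->
  (a - e3 - e1) + (d - e4 - e2) = 0.
Proof. by move=> *; lra. Qed.

(** The commutator [xi, X] is applied to the function g(Y, Z); all other terms
    cancel because xi is Killing and the connection is metric. *)
Lemma lie_nabla_skew U X Y Z p : open U -> U p ->
  smooth_field U X -> smooth_field U Y -> smooth_field U Z ->
  G (lie_nabla X Y) Z p = - G (lie_nabla X Z) Y p.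
Proof.
move=> oU Up XU YU ZU; have sxi : smooth_field U xi := smooth_xi sas.
have sB A B := @smooth_bracket R m M U A B oU.
have sN A B := @smooth_nabla R m M g nabla lc U oU A B.
have sG A B := @smooth_metric_field R m M g U oU A B.
have sD A f := @smooth_dirder R m M U A f oU.
have [bX bY bZ] := And3 (sB _ _ sxi XU) (sB _ _ sxi YU) (sB _ _ sxi ZU).
have [nY nZ] := (sN _ _ XU YU, sN _ _ XU ZU).
have e1 : dirder xi (dirder X (G Y Z)) p
    = G (bracket xi (nabla X Y)) Z p + G (nabla X Y) (bracket xi Z) p
      + (G (bracket xi Y) (nabla X Z) p + G (bracket xi (nabla X Z)) Y p).
  have -> : dirder xi (dirder X (G Y Z)) p
      = dirder xi (fun q => G (nabla X Y) Z q + G Y (nabla X Z) q) p.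
    by apply: (dirder_near _ oU Up) => q Uq; exact: (dirder_metric lc oU XU YU ZU Uq).
  apply: etrans (dirderD xi oU Up (sG _ _ nY ZU) (sG _ _ YU nZ)) (congr2 +%R _ _).
    exact: (lie_metric sas oU nY ZU Up).
  apply: etrans (lie_metric sas oU YU nZ Up) (congr2 +%R _ _) => //.
  exact: metricC.
have e2 : dirder X (dirder xi (G Y Z)) p
    = G (nabla X (bracket xi Y)) Z p + G (bracket xi Y) (nabla X Z) p
      + (G (nabla X Y) (bracket xi Z) p + G (nabla X (bracket xi Z)) Y p).
  have -> : dirder X (dirder xi (G Y Z)) p
      = dirder X (fun q => G (bracket xi Y) Z q + G Y (bracket xi Z) q) p.
    by apply: (dirder_near _ oU Up) => q Uq; exact: (lie_metric sas oU YU ZU Uq).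
  apply: etrans (dirderD X oU Up (sG _ _ bY ZU) (sG _ _ YU bZ)) (congr2 +%R _ _).
    exact: (dirder_metric lc oU XU bY ZU Up).
  apply: etrans (dirder_metric lc oU XU YU bZ Up) (congr2 +%R _ _) => //.
  exact: metricC.
have e3 : dirder (bracket xi X) (G Y Z) p
    = G (nabla (bracket xi X) Y) Z p + G (nabla (bracket xi X) Z) Y p.
  apply: etrans (dirder_metric lc oU bX YU ZU Up) (congr2 +%R _ _) => //.
  exact: metricC.
have e4 := bracketE oU Up sxi XU (sG _ _ YU ZU).
have := lie_nabla_sum e1 e2 e3 e4.
rewrite -!metricBl => /eqP; rewrite addr_eq0 => /eqP.
exact.
Qed.

Lemma lie_nabla_sym_sum (a b c d e f : 'rV[R]_m) :
  a - b = (c - d) + (e - f) -> a - c - e = b - f - d.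
Proof.
move=> h; have -> : a = c - d + (e - f) + b by rewrite -h subrK.
by apply/rowP => i; rewrite !mxE; ring.
Qed.

(** The connection is torsion-free, so this is the Jacobi identity. *)
Lemma lie_nabla_sym U X Y p : open U -> U p ->
  smooth_field U X -> smooth_field U Y -> lie_nabla X Y p = lie_nabla Y X p.
Proof.
move=> oU Up XU YU; have sxi : smooth_field U xi := smooth_xi sas.
have sB A B := @smooth_bracket R m M U A B oU.
have sN A B := @smooth_nabla R m M g nabla lc U oU A B.
have [nXY nYX bXY] := And3 (sN _ _ XU YU) (sN _ _ YU XU) (sB _ _ XU YU).
have tor A B q := @nabla_torsion R m M g nabla lc U oU A B q.
have j := jacobi oU Up sxi XU YU.
have e1 : bracket xi (bracket X Y) p
    = bracket xi (nabla X Y) p - bracket xi (nabla Y X) p.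
  apply: etrans (bracketBr lc oU sxi nXY nYX Up).
  apply: (bracket_eq_r oU sxi bXY (smooth_fieldB oU nXY nYX) _ Up) => q Uq.
  exact: tor.
have e2 := tor _ _ p (sB _ _ sxi XU) YU Up.
have e3 := tor _ _ p XU (sB _ _ sxi YU) Up.
exact: lie_nabla_sym_sum (etrans (esym e1) (etrans j (congr2 +%R e2 e3))).
Qed.

(** An infinitesimal isometry preserves the Levi-Civita connection. *)
Lemma lie_nabla_eq0 U X Y p : open U -> U p ->
  smooth_field U X -> smooth_field U Y -> lie_nabla X Y p = 0.
Proof.
move=> oU Up XU YU; apply: (metric_eq_fields (g := g) oU Up) => V Z oV Vp VU ZV.
rewrite [RHS]metricC metric0r.
have XV := smooth_field_sub VU XU; have YV := smooth_field_sub VU YU.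
apply: (@symmetric_skew_eq0 R (vfield M) (smooth_field V)
  (fun A B C => G (lie_nabla A B) C p) _ _ X Y Z XV YV ZV).
- move=> A B C AV BV CV.
  exact: (congr1 (fun v => g p v (C p)) (lie_nabla_sym oV Vp AV BV)).
- by move=> A B C AV BV CV; exact: (lie_nabla_skew oV Vp).
Qed.

Lemma curvature_xi_sum (u v a b c d e : 'rV[R]_m) :
  u = a - e -> v = b - d -> a - c - b = 0 -> u - v - c = d - e.
Proof.
move=> -> -> h; have -> : a = c + b by apply/eqP; rewrite -subr_eq0 opprD addrA h.
by apply/rowP => i; rewrite !mxE; ring.
Qed.

(** Replacing nabla_xi by the bracket with xi minus phi in R(xi, X) Y leaves the
    Lie derivative of the connection, which is zero, plus (nabla_X phi) Y. *)
Lemma curvature_xi U X Y p : open U -> U p -> smooth_field U X -> smooth_field U Y ->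
  curvature nabla xi X Y p = G X Y p *: xi p - E Y p *: X p.
Proof.
move=> oU Up XU YU; rewrite -(nabla_phiE oU Up XU YU).
have sxi : smooth_field U xi := smooth_xi sas.
have sB A B := @smooth_bracket R m M U A B oU.
have sN A B := @smooth_nabla R m M g nabla lc U oU A B.
have sJ A := @smooth_phi_field R m M g phi xi eta sas U oU A.
have nabla_xi_l A q : smooth_field U A -> U q ->
    nabla xi A q = bracket xi A q - J A q.
  move=> AU Uq; rewrite (nabla_torsion lc oU sxi AU Uq).
  by rewrite (nabla_xi lc sas oU AU Uq) opprK addrK.
have [bY JY nXY] := And3 (sB _ _ sxi YU) (sJ _ YU) (sN _ _ XU YU).
have e1 := nabla_xi_l _ p nXY Up.
have e2 : nabla X (nabla xi Y) p = nabla X (bracket xi Y) p - nabla X (J Y) p.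
  apply: etrans (nablaBr lc oU XU bY JY Up).
  apply: (nabla_eq_r lc oU XU (sN _ _ sxi YU) (smooth_fieldB oU bY JY) _ Up) => q Uq.
  exact: nabla_xi_l.
exact: curvature_xi_sum e1 e2 (lie_nabla_eq0 oU Up XU YU).
Qed.

(** For an orthonormal frame, each R(xi, e_i) e_i is xi - eta(e_i) e_i, and the
    sum of the eta(e_i) e_i is xi. *)
Lemma ricci_xi U Y p : open U -> U p -> smooth_field U Y ->
  ricci g nabla xi Y p = (m%:R - 1) * E Y p.
Proof.
move=> oU Up YU; rewrite /ricci.
have [V [oV Vp [eV ee]]] := frame_atP g p; set e := frame_at g p in eV ee *.
have cE i : curvature nabla xi (e i) (e i) p = xi p - eta p (e i p) *: e i p.
  by rewrite (curvature_xi oV Vp (eV i) (eV i)) /metric_field (ee p Vp) eqxx scale1r.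
under eq_bigr do rewrite cE.
rewrite -metric_suml sumrB sumr_const card_ord metricBl.
have -> : \sum_(i < m) eta p (e i p) *: e i p = xi p.
  rewrite [RHS](orthonormal_expansion (ee p Vp)); apply: eq_bigr => i _.
  by rewrite -(metric_xi acm) metricC.
have -> : g p (xi p *+ m) (Y p) = m%:R * g p (xi p) (Y p).
  by rewrite -scaler_nat metricZl.
by rewrite (metricC g p (xi p)) (metric_xi acm) mulrBl mul1r.
Qed.

End SasakianFormulas.

(** * Generalised Ricci solitons *)

Section SolitonOnSasakian.
Context {R : realType} {m : nat} {M : manifold R m} {g : riemannian_metric M}.
Context {nabla : vfield M -> vfield M -> vfield M} (lc : levi_civita g nabla).
Context {phi : M -> 'rV[R]_m -> 'rV[R]_m} {xi : vfield M} {eta : M -> 'rV[R]_m -> R}.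
Context (sas : sasakian g phi xi eta).
Implicit Types (U : set M) (X Y : vfield M) (p : M) (f : M -> R).
Local Notation J := (phi_field phi).
Local Notation E := (eta_field eta).
Let acm : almost_contact_metric g phi xi eta := sas.1.1.

Lemma hessian_sum (a b c d : R) : a - b = c + d -> a - c = b + d.
Proof. by move=> h; lra. Qed.

(** By the absence of torsion, nabla_xi Y = [xi, Y] - phi Y, and
    [xi, Y] f = xi(Y f) - Y(xi f). *)
Lemma hessian_xi U f Y p : open U -> U p -> smooth_on U f -> smooth_field U Y ->
  hessian g nabla f xi Y p = dirder Y (dirder xi f) p + dirder (J Y) f p.
Proof.
move=> oU Up fU YU; have sxi : smooth_field U xi := smooth_xi sas.
rewrite (hessianE lc oU fU sxi YU Up).
have bE : bracket xi Y p = nabla xi Y p + J Y p.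
  by rewrite (nabla_torsion lc oU sxi YU Up) (nabla_xi lc sas oU YU Up) opprK.
have e1 := bracketE oU Up sxi YU fU.
have e2 : dirder (bracket xi Y) f p = dirder (nabla xi Y) f p + dirder (J Y) f p.
  apply: etrans (dirder_fieldD (nabla xi Y) (J Y) oU Up fU).
  exact: (dirder_vec (Y := fun q => nabla xi Y q + J Y q)).
exact: hessian_sum (etrans (esym e1) e2).
Qed.

Section Soliton.
Context {f1 f2 : M -> R} {c1 c2 lambda : R}.
Context (f1_smooth : smooth_on setT f1) (f2_smooth : smooth_on setT f2).
Context (soliton : generalised_ricci_soliton g nabla f1 f2 c1 c2 lambda).
Let mu : R := c2 * (m%:R - 1) + lambda.

(** The soliton equation at (xi, Y), as an equation between 1-forms. *)
Lemma soliton_xi U Y p : open U -> U p -> smooth_field U Y ->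
  dirder Y (dirder xi f1) p + dirder (J Y) f1 p
  = - c1 * (dirder xi f2 p * dirder Y f2 p) + mu * E Y p.
Proof.
move=> oU Up YU; have f1U : smooth_on U f1 by apply: smooth_on_sub f1_smooth.
rewrite -(hessian_xi oU Up f1U YU).
rewrite (soliton oU (smooth_xi sas) YU Up) (ricci_xi lc sas oU Up YU).
by rewrite (metricC g p (xi p)) (metric_xi acm) /mu [in RHS]mulrDl -[in RHS]mulrA addrA.
Qed.

(** The hypotheses are soliton_xi differentiated along xi, soliton_xi at [xi, Y],
    soliton_xi at phi Y, and soliton_xi_xi differentiated along Y.  The letters
    follow the notation a = xi(f1), b = xi(f2): xYa is xi(Y a), Ja is (phi Y) a,
    Jf2 is (phi Y) f2, and so on. *)
Lemma soliton_sum (xYa xJf xb Yf2 xYf2 xE b Yxa Ja Yb Yf1 EY a Jf2 : R) :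
  xYa + xJf = - c1 * (xb * Yf2 + b * xYf2) + mu * xE ->
  (xYa - Yxa) + (xJf - Ja) = - c1 * (b * (xYf2 - Yb)) + mu * xE ->
  Ja + (- Yf1 + EY * a) = - c1 * (b * Jf2) ->
  Yxa = - c1 * (Yb * b + b * Yb) ->
  Yf1 + c1 * xb * Yf2 - c1 * b * (Yb + Jf2) = a * EY.
Proof. by move=> h1 h2 h3 h4; lra. Qed.

Lemma soliton_xi_xi U p : open U -> U p ->
  dirder xi (dirder xi f1) p = - c1 * (dirder xi f2 p * dirder xi f2 p) + mu.
Proof.
move=> oU Up; have := soliton_xi oU Up (smooth_xi sas).
have -> : dirder (J xi) f1 p = 0.
  apply: etrans (dirder_vec (Y := fun=> 0) _ (phi_xi acm p)) _.
  exact: derive0.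
by rewrite addr0 [E xi p](acm_eta_xi acm) mulr1.
Qed.

(** Subtracting soliton_xi at [xi, Y] from its derivative along xi amounts to
    taking the Lie derivative of an equation between 1-forms. *)
Lemma soliton_field p :
  grad g f1 p + (c1 * dirder xi (dirder xi f2) p) *: grad g f2 p
    - (c1 * dirder xi f2 p) *: nabla xi (grad g f2) p
  = dirder xi f1 p *: xi p.
Proof.
apply: (metric_eq_fields (g := g) (p := p) openT I) => U Y oU Up _ YU.
have sxi : smooth_field U xi := smooth_xi sas.
have f1U : smooth_on U f1 by apply: smooth_on_sub f1_smooth.
have f2U : smooth_on U f2 by apply: smooth_on_sub f2_smooth.
have JU : smooth_field U (J Y) := smooth_phi_field sas oU YU.
have bU : smooth_field U (bracket xi Y) := smooth_bracket oU sxi YU.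
have dU X f : smooth_field U X -> smooth_on U f -> smooth_on U (dirder X f).
  exact: smooth_dirder.
have EU : smooth_on U (E Y) := smooth_eta_field sas oU YU.
have [aU bbU] := (dU _ _ sxi f1U, dU _ _ sxi f2U).
have cst (c : R) : smooth_on U (fun _ : M => c) := smooth_on_cst U c.
have dZ X (c : R) f : smooth_on U f -> dirder X (fun q => c * f q) p = c * dirder X f p.
  by move=> fU; rewrite (dirderM X oU Up (cst c) fU) dirder_cst mul0r add0r.
have e1 : dirder xi (dirder Y (dirder xi f1)) p + dirder xi (dirder (J Y) f1) p
    = - c1 * (dirder xi (dirder xi f2) p * dirder Y f2 p
              + dirder xi f2 p * dirder xi (dirder Y f2) p)
      + mu * dirder xi (E Y) p.
  have bY := smooth_onM oU bbU (dU _ _ YU f2U).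
  apply: etrans (esym (dirderD xi oU Up (dU _ _ YU aU) (dU _ _ JU f1U))) _.
  apply: etrans (dirder_near xi oU Up (fun q Uq => soliton_xi oU Uq YU)) _.
  apply: etrans (dirderD xi oU Up (smooth_onM oU (cst _) bY) (smooth_onM oU (cst _) EU)) _.
  rewrite (dZ xi _ _ bY) (dZ xi _ _ EU).
  by rewrite (dirderM xi oU Up bbU (dU _ _ YU f2U)).
have e2 : (dirder xi (dirder Y (dirder xi f1)) p - dirder Y (dirder xi (dirder xi f1)) p)
    + (dirder xi (dirder (J Y) f1) p - dirder (J Y) (dirder xi f1) p)
    = - c1 * (dirder xi f2 p * (dirder xi (dirder Y f2) p - dirder Y (dirder xi f2) p))
      + mu * dirder xi (E Y) p.
  have h := soliton_xi oU Up bU.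
  have h1 := bracketE oU Up sxi YU aU.
  have h2 : dirder (J (bracket xi Y)) f1 p
      = dirder xi (dirder (J Y) f1) p - dirder (J Y) (dirder xi f1) p.
    apply: etrans (esym _) (bracketE oU Up sxi JU f1U).
    exact: dirder_vec (lie_phi sas oU YU Up).
  have h3 := bracketE oU Up sxi YU f2U.
  have h4 : E (bracket xi Y) p = dirder xi (E Y) p := esym (lie_eta sas oU YU Up).
  apply: etrans (etrans (esym (congr2 +%R h1 h2)) h) _.
  exact: (congr2 (fun s t => - c1 * (dirder xi f2 p * s) + mu * t) h3 h4).
have e3 : dirder (J Y) (dirder xi f1) p + (- dirder Y f1 p + E Y p * dirder xi f1 p)
    = - c1 * (dirder xi f2 p * dirder (J Y) f2 p).
  have h := soliton_xi oU Up JU.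
  have h1 : dirder (J (J Y)) f1 p = - dirder Y f1 p + E Y p * dirder xi f1 p.
    have JJ := acm_phi2 acm p (Y p).
    apply: etrans (dirder_vec (Y := fun q => - Y q + E Y q *: xi q) _ JJ) _.
    apply: etrans (dirder_fieldD (fun q => - Y q) (fun q => E Y q *: xi q) oU Up f1U) _.
    rewrite (dirder_fieldZ xi (E Y) oU Up f1U); congr (_ + _).
    have nY : - Y p = -1 *: Y p by rewrite scaleN1r.
    apply: etrans (dirder_vec (Y := fun q => -1 *: Y q) _ nY) _.
    by rewrite (dirder_fieldZ Y (fun=> -1) oU Up f1U) mulN1r.
  rewrite h1 in h; rewrite h.
  by rewrite [E (J Y) p](eta_phi acm) mulr0 addr0.
have e4 : dirder Y (dirder xi (dirder xi f1)) p
    = - c1 * (dirder Y (dirder xi f2) p * dirder xi f2 p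
              + dirder xi f2 p * dirder Y (dirder xi f2) p).
  have bb := smooth_onM oU bbU bbU.
  apply: etrans (dirder_near Y oU Up (fun q Uq => soliton_xi_xi oU Uq)) _.
  apply: etrans (dirderD Y oU Up (smooth_onM oU (cst _) bb) (cst mu)) _.
  by rewrite dirder_cst addr0 (dZ Y _ _ bb) (dirderM Y oU Up bbU bbU).
have := soliton_sum e1 e2 e3 e4.
rewrite -(hessian_xi oU Up f2U YU) => h.
rewrite metricBl metricDl !metricZl (gradP g Y oU Up f1U) (gradP g Y oU Up f2U).
by rewrite (metricC g p (xi p)) (metric_xi acm).
Qed.

End Soliton.
End SolitonOnSasakian.

Theorem theorem1p4 (R : realType) (n : nat) (M : manifold R (n.*2).+1)
    (g : riemannian_metric M) (nabla : vfield M -> vfield M -> vfield M)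
    (phi : M -> 'rV[R]_((n.*2).+1) -> 'rV[R]_((n.*2).+1))
    (xi : vfield M) (eta : M -> 'rV[R]_((n.*2).+1) -> R)
    (f1 f2 : M -> R) (c1 c2 lambda : R)
    (h_nabla : levi_civita g nabla)
    (h_sasakian : sasakian g phi xi eta)
    (h_f1 : smooth_on setT f1) (h_f2 : smooth_on setT f2)
    (h_soliton : generalised_ricci_soliton g nabla f1 f2 c1 c2 lambda) :
  forall p : M,
    grad g f1 p
      + (c1 * dirder xi (dirder xi f2) p) *: grad g f2 p
      - (c1 * dirder xi f2 p) *: nabla xi (grad g f2) p
    = dirder xi f1 p *: xi p.
Proof. exact: (soliton_field h_nabla h_sasakian h_f1 h_f2 h_soliton). Qed.
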